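(* Let $K$ be a number field, and let $(V,\psi)$, $D$, $(V_{\mathrm{DR}},\psi_{\mathrm{DR}})$ and the family of $l$-adic representations $\rho_l\colon G_K\to \mathrm{GIso}_{(V_l,\psi_l)}(\mathbb{Q}_l)$ satisfy the standing assumptions listed in the context, with arbitrary weight $n\neq 0$. Let $l$ be a prime number and let $K_0/K$ be the finite Galois extension with $\rho_l^{-1}\big((G_{l,K}^{\mathrm{alg}})^{\circ}(\mathbb{Q}_l)\big)=G_{K_0}$. Assume that: (1) $K_0\cap K(\mu_{\bar l}^{\otimes n})=K$, (2) $(1+l\mathbb{Z}_l)\,\mathrm{Id}_{V_l}\subset\rho_l(G_K)$, (3) $-\mathrm{Id}_{V_l}\in(G_{l,K,1}^{\mathrm{alg}})^{\circ}$. Then $\overline{\rho_l(G_K)_1}=G_{l,K,1}^{\mathrm{alg}}$, where $\rho_l(G_K)_1:=\rho_l(G_K)\cap\mathrm{Iso}_{(V_l,\psi_l)}(\mathbb{Q}_l)$ and the bar denotes Zariski closure.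
   Context: Standing setting. $K$ is a number field, $G_K=\mathrm{Gal}(\overline K/K)$. $(V,\psi)$ is a rational polarized pure Hodge structure of weight $n$, $\psi\colon V\times V\to\mathbb{Q}(-n)$. $\mathrm{GIso}_{(V,\psi)}$ is the group of $g\in\mathrm{GL}_V$ with $\psi(gv,gw)=\chi(g)\psi(v,w)$ for some $\chi(g)\in\mathbb{G}_m$ and all $v,w$; $\mathrm{Iso}_{(V,\psi)}=\ker\chi$. For each prime $l$, $V_l=V\otimes\mathbb{Q}_l$, $\psi_l=\psi\otimes\mathbb{Q}_l$ (with the analogous groups), and $\rho_l$ is a continuous representation of $G_K$ on $V_l$ for which $\psi_l\colon V_l\times V_l\to\mathbb{Q}_l(-n)$ is $G_K$-equivariant. Assumptions: (D1) $D\subseteq\mathrm{End}_{\mathbb{Q}}(V)$ is a ring whose action on $V\otimes\mathbb{C}$ preserves the Hodge decomposition. (D2) $D$ has a structure of discrete $G_K$-module, giving $\rho_e\colon G_K\to\mathrm{Aut}_{\mathbb{Q}}(D)$. De Rham data: a $K$-vector space $V_{\mathrm{DR}}$ with a nondegenerate bilinear pairing $\psi_{\mathrm{DR}}\colon V_{\mathrm{DR}}\times V_{\mathrm{DR}}\to K(-n)$, a decreasing filtration $F^iV_{\mathrm{DR}}$ with graded pieces $G^iV_{\mathrm{DR}}$, and for each embedding $\sigma\colon K\to\mathbb{C}$ an isomorphism $V\otimes_{\mathbb{Q}}\mathbb{C}\simeq V_{\mathrm{DR}}\otimes_{K,\sigma}\mathbb{C}$ compatible with the forms and with the Hodge filtrations.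 (DR1) There is a canonical embedding $D\subseteq\mathrm{End}_{\overline K}(V_{\mathrm{DR}}\otimes_K\overline K)$ compatible with these comparison isomorphisms. (DR2) The action of $D$ preserves the decomposition $V\otimes\mathbb{C}=\bigoplus_i G^iV_{\mathrm{DR}}\otimes_{K,\sigma}\mathbb{C}$. (R1) $(\rho_l)_l$ is strictly compatible in the sense of Serre and $\rho_l$ is of Hodge--Tate type at every prime of $\mathcal{O}_K$ over $l$. (R2) For each $l$ and each prime $v$ outside a finite set containing all primes over $l$, the eigenvalues of an (arithmetic) Frobenius at $v$ have complex absolute value $q_v^{-n/2}$. (R3) For each prime $\lambda\mid l$ there is a Hodge--Tate decomposition $V_l\otimes_{\mathbb{Q}_l}\mathbb{C}_l=\bigoplus_i G^iV_{\mathrm{DR}}\otimes_K\mathbb{C}_l(i-n)$, $\mathbb{C}_l=\widehat{\overline K}_\lambda$. (R4) $\rho_l(\sigma)(\beta v)=\sigma(\beta)\rho_l(\sigma)(v)$ for $\beta\in D$, $v\in V_l$, $\sigma\in G_K$, and the action of $D$ on $V_l\otimes\mathbb{C}_l$ is compatible with (R3). For a finite extension $L/K$, $G_{l,L}^{\mathrm{alg}}$ is the Zariski closure of $\rho_l(G_L)$ in $\mathrm{GIso}_{(V_l,\psi_l)}$ and $G_{l,L,1}^{\mathrm{alg}}:=G_{l,L}^{\mathrm{alg}}\cap\mathrm{Iso}_{(V_l,\psi_l)}$; $\circ$ denotes the identity component. $\bar l:=l$ if $l>2$ and $\bar l:=8$ if $l=2$. $K(\mu_{\bar l}^{\otimes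 n})$ is the fixed field of the kernel of the action of $G_K$ on $\mu_{\bar l}^{\otimes n}$, i.e. of the $n$-th power of the mod $\bar l$ cyclotomic character. *)

(* Defs.v *)
From HB Require Import structures.
From mathcomp Require Import all_boot all_order all_algebra all_field.
From mathcomp Require Import boolp classical_sets cardinality reals.
From mathcomp Require Import complex mpoly.
From mathcomp Require trigo.
Set Implicit Arguments.
Unset Strict Implicit.
Unset Printing Implicit Defensive.
Import Order.TTheory GRing.Theory Num.Theory.
Local Open Scope classical_set_scope.
Local Open Scope ring_scope.

(* A finite-dimensional E-vector space is taken in coordinates, as the column  *)
(* vectors 'cV[E]_d; a base change E -> E' is then map_mx.                      *)

Definition prime_nat := {l : nat | prime l}.
Definition nat_of_prime (l : prime_nat) : nat := sval l.
Coercion nat_of_prime : prime_nat >-> nat.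

Section LinearAlgebra.
Variables (E : fieldType) (d : nat).

Definition bform (B : 'M[E]_d) (x y : 'cV[E]_d) : E := (x^T *m B *m y) 0 0.

Definition mx_img (M : 'M[E]_d) (U : {vspace 'cV[E]_d}) : {vspace 'cV[E]_d} :=
  (linfun (mulmx M : 'cV[E]_d -> 'cV[E]_d) @: U)%VS.

Definition base_change (E' : fieldType) (f : E -> E') (U : {vspace 'cV[E]_d}) :
    {vspace 'cV[E']_d} :=
  <<map (map_mx f) (vbasis U)>>%VS.

(* The whole space is the direct sum of the H i, almost all of which are 0. *)
Definition is_decomposition (I : eqType) (H : I -> {vspace 'cV[E]_d}) : Prop :=
  exists s : seq I,
    [/\ uniq s, forall i, i \notin s -> H i = 0%VS,
        directv (\sum_(i <- s) H i)
      & (\sum_(i <- s) H i)%VS = fullv].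

Definition GIso (B : 'M[E]_d) : set 'M[E]_d :=
  [set g | g \in unitmx /\
    exists2 c : E, c != 0 &
      forall v w, bform B (g *m v) (g *m w) = c * bform B v w].

Definition Iso (B : 'M[E]_d) : set 'M[E]_d :=
  [set g | g \in unitmx /\
    forall v w, bform B (g *m v) (g *m w) = bform B v w].

End LinearAlgebra.

Section Fields.

Record alg_closure (E : fieldType) := AlgClosure {
  ac_sort :> closedFieldType;
  ac_emb : {rmorphism E -> ac_sort};
  ac_algebraic : forall x : ac_sort, algebraicOver ac_emb x }.

Variable R : realType.

Definition ultrametric_abs (E : fieldType) (w : E -> R) : Prop :=
  [/\ forall x, 0 <= w x,
      forall x, w x = 0 <-> x = 0,
      forall x y, w (x * y) = w x * w y
    & forall x y, w (x + y) <= Num.max (w x) (w y)].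

Record completion (E : fieldType) (w : E -> R) := Completion {
  cp_sort :> fieldType;
  cp_emb : {rmorphism E -> cp_sort};
  cp_norm : cp_sort -> R;
  cp_ultrametric : ultrametric_abs cp_norm;
  cp_extends : forall x, cp_norm (cp_emb x) = w x;
  cp_dense : forall (y : cp_sort) (eps : R), 0 < eps ->
    exists x : E, cp_norm (y - cp_emb x) < eps;
  cp_complete : forall u : nat -> cp_sort,
    (forall eps : R, 0 < eps -> exists N : nat, forall i j : nat,
       (N <= i)%N -> (N <= j)%N -> cp_norm (u i - u j) < eps) ->
    exists y : cp_sort, forall eps : R, 0 < eps ->
      exists N : nat, forall i : nat, (N <= i)%N -> cp_norm (u i - y) < eps }.

Definition padic_norm (l : nat) (x : rat) : R :=
  if x == 0 then 0
  else l%:R ^ ((logn l `|denq x|%N)%:Z - (logn l `|numq x|%N)%:Z).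

(* The field Q_l, determined up to a unique isometric isomorphism. *)
Definition padic_field (l : nat) := completion (padic_norm l).

(* A prime of a number field, or of an algebraic closure of it, lying over p   *)
(* is encoded by the absolute value extending the p-adic one.                  *)
Definition is_place (p : nat) (E : fieldType) (w : E -> R) : Prop :=
  ultrametric_abs w /\ forall x : rat, w (ratr x) = padic_norm p x.

Definition residue_card (E : fieldType) (w : E -> R) (q : nat) : Prop :=
  exists f : 'I_q -> E,
    (forall i, w (f i) <= 1) /\
    (forall x, w x <= 1 -> exists! i, w (x - f i) < 1).

End Fields.

Section Galois.
Variables (R : realType) (K : fieldType) (Kbar : alg_closure K).

Record absGal := AbsGal {
  gal_map :> {rmorphism Kbar -> Kbar};
  gal_bij : bijective gal_map;
  gal_fix : forall x : K, gal_map (ac_emb Kbar x) = ac_emb Kbar x }.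

Definition gal_one : absGal :=
  @AbsGal (idfun : {rmorphism Kbar -> Kbar}) (Bijective (frefl _) (frefl _))
    (fun x => erefl _).

Lemma gal_mul_fix (sigma tau : absGal) (x : K) :
  sigma (tau (ac_emb Kbar x)) = ac_emb Kbar x.
Proof. by rewrite !gal_fix. Qed.

Definition gal_mul (sigma tau : absGal) : absGal :=
  @AbsGal (gal_map sigma \o gal_map tau : {rmorphism Kbar -> Kbar})
    (bij_comp (gal_bij sigma) (gal_bij tau)) (gal_mul_fix sigma tau).

Definition fixed_field (A : set absGal) : set Kbar :=
  [set x | forall sigma, A sigma -> sigma x = x].

Section Place.
Variable w : Kbar -> R.

Definition restr_place : K -> R := fun x => w (ac_emb Kbar x).

Definition decomposition_group : set absGal :=
  [set sigma | forall x, w (sigma x) = w x].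

Definition inertia_group : set absGal :=
  [set sigma | decomposition_group sigma /\
    forall x, w x <= 1 -> w (sigma x - x) < 1].

Definition arith_frobenius (q : nat) : set absGal :=
  [set sigma | [/\ residue_card restr_place q, decomposition_group sigma
    & forall x, w x <= 1 -> w (sigma x - x ^+ q) < 1]].

End Place.

(* The l-adic cyclotomic character with values in Z_l^x, inside Q_l. *)
Definition is_cyclotomic_character (l : nat) (Ql : padic_field R l)
    (chi : absGal -> Ql) : Prop :=
  forall sigma : absGal, cp_norm (chi sigma) <= 1 /\
    forall (m a : nat) (zeta : Kbar), zeta ^+ (l ^ m) = 1 ->
      cp_norm (chi sigma - a%:R) <= l%:R ^- m -> sigma zeta = zeta ^+ a.

(* The kernel of the action of G_K on the n-th tensor power of mu_N, 1 < N. *)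
Definition mu_tensor_kernel (N : nat) (n : int) : set absGal :=
  [set sigma | exists a : nat,
    (forall zeta : Kbar, zeta ^+ N = 1 -> sigma zeta = zeta ^+ a) /\
    (a%:R : 'Z_N) ^ n = 1].

End Galois.

Definition lbar (l : nat) : nat := if l == 2%N then 8%N else l.

Section Zariski.
(* Om is an algebraic closure of k. A variety X over k in the space of d x d   *)
(* matrices is represented by X(Om), with the topology whose closed sets are   *)
(* the zero loci of polynomials with coefficients in k. The scheme X over k    *)
(* and X(Om) have the same lattice of closed sets, hence the same connected    *)
(* components, and the identity component of an algebraic group over k is      *)
(* geometrically connected. Closed subsets of GL_d are also cut out by         *)
(* polynomials not involving 1/det.                                            *)
Variables (k : fieldType) (Om : alg_closure k) (d : nat).

Definition mx_eval (p : {mpoly k[d * d]}) (g : 'M[Om]_d) : Om :=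
  (map_mpoly (ac_emb Om) p).@[fun i => mxvec g 0 i].

Definition zariski_closed (A : set 'M[Om]_d) : Prop :=
  exists P : set {mpoly k[d * d]},
    A = [set g | forall p, P p -> mx_eval p g = 0].

Definition zariski_closure (X S : set 'M[Om]_d) : set 'M[Om]_d :=
  [set g | X g /\ forall C, zariski_closed C -> S `<=` C -> C g].

Definition zariski_connected (A : set 'M[Om]_d) : Prop :=
  forall C1 C2, zariski_closed C1 -> zariski_closed C2 ->
    A `<=` C1 `|` C2 -> A `&` C1 `&` C2 = set0 -> A `<=` C1 \/ A `<=` C2.

Definition identity_component (X : set 'M[Om]_d) : set 'M[Om]_d :=
  [set g | exists A, [/\ A `<=` X, zariski_connected A, A 1%:M & A g]].

End Zariski.

Section HodgeStructure.
Variables (R : realType) (d : nat) (n : int).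
Variables (H : int -> int -> {vspace 'cV[R[i]]_d}) (psi : 'M[rat]_d).

Definition hodge_structure : Prop :=
  [/\ is_decomposition (fun pq : int * int => H pq.1 pq.2),
      forall p q, p + q != n -> H p q = 0%VS
    & forall p q (x : 'cV[R[i]]_d), x \in H p q -> map_mx (@conjc R) x \in H q p].

Definition psiC : 'M[R[i]]_d := map_mx ratr psi.

(* Q(-n) is the line (2 pi i)^-n Q in C. The pairing V x V -> Q(-n) is         *)
(* (2 pi i)^-n psi, so the polarization form (2 pi i)^n psi(v, h(i) w) is the  *)
(* one below, with h(i) = i^(q-p) on H^{p,q}.                                  *)
Definition polarization : Prop :=
  (forall p q p' q' x y, x \in H p q -> y \in H p' q' ->
     (p + p', q + q') != (n, n) -> bform psiC x y = 0) /\
  exists W : 'M[R[i]]_d,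
    [/\ forall p q x, x \in H p q -> W *m x = ('i : R[i]) ^ (q - p) *: x,
        forall v w : 'cV[R]_d,
          bform psiC (map_mx (real_complex R) v) (W *m map_mx (real_complex R) w)
          = bform psiC (map_mx (real_complex R) w) (W *m map_mx (real_complex R) v)
      & forall v : 'cV[R]_d, v != 0 ->
          0 < bform psiC (map_mx (real_complex R) v)
                         (W *m map_mx (real_complex R) v)].

Definition hodge_filtration (i : int) : set 'cV[R[i]]_d :=
  [set x | exists2 s : seq (int * int), all (fun pq => i <= pq.1) s
         & x \in (\sum_(pq <- s) H pq.1 pq.2)%VS].

Definition hodge_endomorphism (beta : 'M[rat]_d) : Prop :=
  forall p q, (mx_img (map_mx ratr beta) (H p q) <= H p q)%VS.

End HodgeStructure.

Definition is_subring (d : nat) (D : set 'M[rat]_d) : Prop :=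
  [/\ D 1%:M, forall a b, D a -> D b -> D (a - b)
    & forall a b, D a -> D b -> D (a *m b)].

(* Compatibility of the action with products in D is not required: it follows  *)
(* from the equivariance of the action of D on V_l.                            *)
Definition discrete_galois_action (K : fieldType) (Kbar : alg_closure K)
    (d : nat) (D : set 'M[rat]_d)
    (rho_e : absGal Kbar -> 'M[rat]_d -> 'M[rat]_d) : Prop :=
  [/\ forall sigma b, D b -> D (rho_e sigma b),
      (forall b, D b -> rho_e (gal_one Kbar) b = b) /\
      (forall sigma tau b, D b ->
         rho_e (gal_mul sigma tau) b = rho_e sigma (rho_e tau b)),
      forall sigma a b, D a -> D b ->
        rho_e sigma (a + b) = rho_e sigma a + rho_e sigma b,
      forall sigma (c : rat) b, D b -> D (c *: b) ->
        rho_e sigma (c *: b) = c *: rho_e sigma b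
    & forall b, D b -> exists s : seq Kbar, forall sigma : absGal Kbar,
        (forall x, x \in s -> sigma x = x) -> rho_e sigma b = b].

Section DeRham.
Variables (R : realType) (K : fieldType) (Kbar : alg_closure K).
Variables (d : nat) (n : int).
Variables (H : int -> int -> {vspace 'cV[R[i]]_d}) (psi : 'M[rat]_d).
Variables (D : set 'M[rat]_d).
Variables (F : int -> {vspace 'cV[K]_d}) (psiDR : 'M[K]_d).
Variable cmp : {rmorphism K -> R[i]} -> 'M[R[i]]_d.
Variable jD : 'M[rat]_d -> 'M[Kbar]_d.

Definition twopii : R[i] := (trigo.pi *+ 2 : R)%:C%C * 'i.

(* The factor (2 pi i)^-n is the comparison of the lattices of Q(-n) and K(-n). *)
Definition de_rham_comparison : Prop :=
  [/\ psiDR \in unitmx,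
      forall i j : int, i <= j -> (F j <= F i)%VS,
      forall sigma : {rmorphism K -> R[i]}, cmp sigma \in unitmx,
      forall (sigma : {rmorphism K -> R[i]}) (x y : 'cV[R[i]]_d),
        bform (map_mx sigma psiDR) (cmp sigma *m x) (cmp sigma *m y)
        = twopii ^ (- n) * bform (psiC R psi) x y
    & forall (sigma : {rmorphism K -> R[i]}) i (x : 'cV[R[i]]_d),
        hodge_filtration H i x <-> cmp sigma *m x \in base_change sigma (F i)].

(* The embedding sigma of K only sees V_DR \otimes_K Kbar through some         *)
(* extension tau of sigma to Kbar.                                             *)
Definition de_rham_embedding : Prop :=
  [/\ jD 1%:M = 1%:M,
      forall a b, D a -> D b -> jD (a + b) = jD a + jD b,
      forall a b, D a -> D b -> jD (a *m b) = jD a *m jD b,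
      forall a b, D a -> D b -> jD a = jD b -> a = b
    & forall sigma : {rmorphism K -> R[i]},
        exists2 tau : {rmorphism Kbar -> R[i]},
          forall x : K, tau (ac_emb Kbar x) = sigma x
        & forall b, D b ->
            map_mx tau (jD b) *m cmp sigma = cmp sigma *m map_mx ratr b].

(* The copy of (F^i / F^(i+1)) \otimes_sigma C inside V_DR \otimes_sigma C is   *)
(* the image of H^{i,n-i} under the comparison isomorphism.                     *)
Definition de_rham_summand (sigma : {rmorphism K -> R[i]}) (i : int) :
    {vspace 'cV[R[i]]_d} :=
  mx_img (cmp sigma) (H i (n - i)).

Definition de_rham_preserved : Prop :=
  forall (sigma : {rmorphism K -> R[i]}) i b, D b ->
    (mx_img (cmp sigma *m map_mx ratr b *m invmx (cmp sigma))
       (de_rham_summand sigma i) <= de_rham_summand sigma i)%VS.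

End DeRham.

Section Representation.
Variables (R : realType) (K : fieldType) (Kbar : alg_closure K).
Variables (l : nat) (Ql : padic_field R l) (chi : absGal Kbar -> Ql).
Variables (d : nat) (n : int) (psi : 'M[rat]_d).
Variable rho : absGal Kbar -> 'M[Ql]_d.

Definition continuous_rep : Prop :=
  [/\ rho (gal_one Kbar) = 1%:M,
      forall sigma tau, rho (gal_mul sigma tau) = rho sigma *m rho tau
    & forall (sigma : absGal Kbar) (eps : R), 0 < eps ->
        exists s : seq Kbar, forall tau : absGal Kbar,
          (forall x, x \in s -> tau x = sigma x) ->
          forall i j, cp_norm (rho tau i j - rho sigma i j) < eps].

Definition psil : 'M[Ql]_d := map_mx (cp_emb Ql) psi.

Definition psil_equivariant : Prop :=
  forall sigma (v w : 'cV[Ql]_d),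
    bform psil (rho sigma *m v) (rho sigma *m w) = chi sigma ^ (- n) * bform psil v w.

Section HodgeTate.
Variables (w : Kbar -> R) (Cw : completion w).

(* s is the continuous extension to C_l of an element of the decomposition     *)
(* group; e is the embedding of Q_l in C_l.                                    *)
Definition extends_gal (sigma : absGal Kbar) (s : {rmorphism Cw -> Cw}) : Prop :=
  (forall x, cp_norm (s x) = cp_norm x) /\
  (forall x : Kbar, s (cp_emb Cw x) = cp_emb Cw (sigma x)).

Definition isometric (e : {rmorphism Ql -> Cw}) : Prop :=
  forall x, cp_norm (e x) = cp_norm x.

(* V_l \otimes C_l is a direct sum of twists C_l(m_j), with C_l-basis the      *)
(* columns of B.                                                               *)
Definition hodge_tate_at : Prop :=
  forall e, isometric e ->
  exists (B : 'M[Cw]_d) (m : 'I_d -> int), B \in unitmx /\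
    forall sigma s, decomposition_group w sigma -> extends_gal sigma s ->
    forall j, map_mx e (rho sigma) *m map_mx s (col j B)
              = e (chi sigma) ^ (m j) *: col j B.

(* phi i induces the C_l-linear injection of                                   *)
(* (F^i / F^(i+1)) \otimes_K C_l(i-n) in V_l \otimes C_l.                      *)
Definition hodge_tate_decomposition (D : set 'M[rat]_d)
    (F : int -> {vspace 'cV[K]_d}) (jD : 'M[rat]_d -> 'M[Kbar]_d) : Prop :=
  let F_ i : {vspace 'cV[Cw]_d} :=
    base_change (cp_emb Cw \o ac_emb Kbar) (F i) in
  forall e, isometric e ->
  exists phi : int -> 'M[Cw]_d,
    [/\ forall i x, x \in F_ i -> (phi i *m x = 0 <-> x \in F_ (i + 1)),
        is_decomposition (fun i => mx_img (phi i) (F_ i)),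
        forall i (x : 'cV[K]_d), x \in F i ->
          let y := phi i *m map_mx (cp_emb Cw \o ac_emb Kbar) x in
          forall sigma s, decomposition_group w sigma -> extends_gal sigma s ->
          map_mx e (rho sigma) *m map_mx s y = e (chi sigma) ^ (i - n) *: y
      & forall b, D b -> forall i x, x \in F_ i ->
          map_mx (e \o cp_emb Ql) b *m (phi i *m x)
          = phi i *m (map_mx (cp_emb Cw) (jD b) *m x)].

End HodgeTate.

(* Weil numbers: eigenvalues in an algebraic closure of Q_l that are algebraic  *)
(* over Q and all of whose complex conjugates have the prescribed absolute      *)
(* value.                                                                       *)
Definition frobenius_weights (Qlbar : alg_closure Ql) : Prop :=
  exists S : set (K -> R),
    [/\ finite_set S, forall v : K -> R, is_place l v -> S v
      & forall (p : nat) (w : Kbar -> R) (q : nat) (Fr : absGal Kbar),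
          prime p -> is_place p w -> ~ S (restr_place w) ->
          arith_frobenius w q Fr ->
          forall alpha : Qlbar,
            eigenvalue (map_mx (ac_emb Qlbar) (rho Fr)) alpha ->
            exists P : {poly rat},
              [/\ irreducible_poly P,
                  root (map_poly (ac_emb Qlbar \o cp_emb Ql) P) alpha
                & forall z : R[i], root (map_poly ratr P) z ->
                    `|z| = (Num.sqrt (q%:R : R) ^ (- n))%:C%C]].

Definition D_equivariant (D : set 'M[rat]_d)
    (rho_e : absGal Kbar -> 'M[rat]_d -> 'M[rat]_d) : Prop :=
  forall b, D b -> forall sigma (v : 'cV[Ql]_d),
    rho sigma *m (map_mx (cp_emb Ql) b *m v)
    = map_mx (cp_emb Ql) (rho_e sigma b) *m (rho sigma *m v).

Definition rho_scalars : Prop :=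
  forall u : Ql, cp_norm (u - 1) <= l%:R^-1 -> exists sigma, rho sigma = u%:M.

Section AlgebraicMonodromy.
Variable Qlbar : alg_closure Ql.

Definition to_bar (g : 'M[Ql]_d) : 'M[Qlbar]_d := map_mx (ac_emb Qlbar) g.

Definition Galg : set 'M[Qlbar]_d :=
  zariski_closure (GIso (to_bar psil)) [set to_bar (rho sigma) | sigma in setT].

Definition Galg1 : set 'M[Qlbar]_d := Galg `&` Iso (to_bar psil).

Definition rho_image1 : set 'M[Ql]_d := range rho `&` Iso psil.

End AlgebraicMonodromy.

End Representation.

Arguments mu_tensor_kernel {K} Kbar N n.
Arguments Galg {R K Kbar l Ql d} psi rho Qlbar.
Arguments Galg1 {R K Kbar l Ql d} psi rho Qlbar.

Definition strictly_compatible (R : realType) (K : fieldType)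
    (Kbar : alg_closure K) (d : nat)
    (Q_ : forall l : prime_nat, padic_field R l)
    (rho : forall l : prime_nat, absGal Kbar -> 'M[Q_ l]_d) : Prop :=
  exists (S : set (K -> R)) (P : (K -> R) -> {poly rat}),
    finite_set S /\
    forall (l : prime_nat) (p : nat) (w : Kbar -> R),
      prime p -> p != l -> is_place p w -> ~ S (restr_place w) ->
      (forall sigma, inertia_group w sigma -> rho l sigma = 1%:M) /\
      (forall q Fr, arith_frobenius w q Fr ->
         \det (1%:M - 'X *: map_mx polyC (rho l Fr))
         = map_poly (cp_emb (Q_ l)) (P (restr_place w))).

(* Main.v *)
Require Import Defs.
From HB Require Import structures.
From mathcomp Require Import all_boot all_order all_algebra all_field.
From mathcomp Require Import boolp classical_sets cardinality reals.
From mathcomp Require Import complex mpoly.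
From mathcomp Require Import fingroup cyclic ring.
Set Implicit Arguments.
Unset Strict Implicit.
Unset Printing Implicit Defensive.
Import Order.TTheory GRing.Theory Num.Theory.
Local Open Scope classical_set_scope.
Local Open Scope ring_scope.

(* Write [Gamma] for the image of [rho_l], [Gamma_1] for its isometries, and   *)
(* [N] for the kernel of the action on the [n]-th power of [mu_lbar]. For      *)
(* [sigma] in [N] the multiplier of [rho_l sigma] is 1 mod [lbar], hence the   *)
(* square of some [u] in [1 + l Z_l]; by (2) the homothety [u] lies in         *)
(* [Gamma], so [rho_l sigma] is in [u Gamma_1]. By (1), [N] surjects onto      *)
(* Gal(K_0/K), so [rho_l N] meets every component of the algebraic monodromy   *)
(* group; having finite index in [Gamma], it is Zariski dense there. Hence     *)
(* [Galg] is the closure of homotheties times [Gamma_1], and [Galg1] lies in   *)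
(* the union of [C] and [- C], with [C] the closure of [Gamma_1]. If [-1] were *)
(* not in [C], these two cosets would be disjoint, and a connected subset of   *)
(* [Galg1] containing 1 could not contain [-1], against (3). So [C = - C].     *)

(** * Polynomial functions on matrices *)

(** The passage to closures rests on three facts. A polynomial with coefficients in [Om] that
    vanishes on a set of [k]-rational matrices vanishes on its closure over [k]
    ([polyfun_vanishes]), so the invertible matrices in the closure of a group form a group
    ([closure_of_mulmx], [closure_of_invmx]). A connected set of invertible matrices through 1,
    inside the closure of finitely many cosets of a group [T], lies in the closure of [T]
    ([connected_subset_closure]); this serves once for the image of the finite-index kernel
    ([Galg_kernel]) and once for the isometries and their negatives ([rho_image1_dense]). Scalars in
    a product of homotheties and isometries can be removed inside the isometry group at the price of
    a sign ([Iso_closure_of]), and hypothesis (3) settles that sign.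

    The arithmetic input is that on the kernel the multiplier has a square root among the scalars in
    the image ([cyclotomic_close1] and [padic_sqrt], combined in [mu_tensor_kernel_scalar]), and
    that by hypothesis (1) the kernel induces every automorphism of $K_0$ over $K$
    ([absGal_factorization]). *)

Section PolynomialFunctions.
Variables (E : fieldType) (d : nat).

(** Functions rather than terms of [{mpoly}], so that matrix operations can be substituted without
    tracking indices. The set of constants is a parameter because coefficients in [k] and in all of
    [Om] both occur. *)
Inductive polyfun (S : set E) : ('M[E]_d -> E) -> Prop :=
| polyfun_const c of S c : polyfun S (fun=> c)
| polyfun_coord i j : polyfun S (fun g => g i j)
| polyfun_add f1 f2 of polyfun S f1 & polyfun S f2 :
    polyfun S (fun g => f1 g + f2 g)
| polyfun_mul f1 f2 of polyfun S f1 & polyfun S f2 :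
    polyfun S (fun g => f1 g * f2 g).

Lemma polyfun_subset (S S' : set E) f : S `<=` S' -> polyfun S f -> polyfun S' f.
Proof.
move=> sub; elim=> [c /sub|i j|f1 f2 _ h1 _ h2|f1 f2 _ h1 _ h2].
- exact: polyfun_const.
- exact: polyfun_coord.
- exact: polyfun_add.
- exact: polyfun_mul.
Qed.

Lemma eq_polyfun (S : set E) f g : f =1 g -> polyfun S g -> polyfun S f.
Proof. by move=> /funext ->. Qed.

Lemma polyfun_comp (S : set E) f (phi : 'M[E]_d -> 'M[E]_d) :
  polyfun S f -> (forall i j, polyfun S (fun g => phi g i j)) ->
  polyfun S (fun g => f (phi g)).
Proof.
move=> hf hphi; elim: hf => [c|i j|f1 f2 _ h1 _ h2|f1 f2 _ h1 _ h2].
- exact: polyfun_const.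
- exact: hphi.
- exact: polyfun_add.
- exact: polyfun_mul.
Qed.

Variables (k : fieldType) (emb : {rmorphism k -> E}).
Let S := range emb.

Lemma polyfun_scalar (c : k) : polyfun S (fun=> emb c).
Proof. by apply: polyfun_const; exists c. Qed.

Lemma polyfun_nat (c : nat) : polyfun S (fun=> c%:R).
Proof. by rewrite -(rmorph_nat emb); exact: polyfun_scalar. Qed.

Lemma polyfun_exp f n : polyfun S f -> polyfun S (fun g => f g ^+ n).
Proof.
move=> hf; elim: n => [|n IH]; first exact: (polyfun_nat 1).
under eq_fun do rewrite exprS; exact: polyfun_mul.
Qed.

Lemma polyfun_sum (I : Type) (s : seq I) (P : pred I) (F : I -> 'M[E]_d -> E) :
  (forall i, polyfun S (F i)) -> polyfun S (fun g => \sum_(i <- s | P i) F i g).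
Proof.
move=> hF; elim: s => [|i s IH].
  by under eq_fun do rewrite big_nil; exact: (polyfun_nat 0).
under eq_fun do rewrite big_cons; case: (P i) => //.
exact: polyfun_add.
Qed.

Lemma polyfun_prod (I : Type) (s : seq I) (P : pred I) (F : I -> 'M[E]_d -> E) :
  (forall i, polyfun S (F i)) -> polyfun S (fun g => \prod_(i <- s | P i) F i g).
Proof.
move=> hF; elim: s => [|i s IH].
  by under eq_fun do rewrite big_nil; exact: (polyfun_nat 1).
under eq_fun do rewrite big_cons; case: (P i) => //.
exact: polyfun_mul.
Qed.

Lemma polyfun_det n (F : 'M[E]_d -> 'M[E]_n) :
  (forall i j, polyfun S (fun g => F g i j)) -> polyfun S (fun g => \det (F g)).
Proof.
move=> hF; apply: polyfun_sum => s; apply: polyfun_mul.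
  rewrite -(rmorph_sign emb); exact: polyfun_scalar.
exact: polyfun_prod.
Qed.

Lemma polyfun_adj i j : polyfun S (fun g => (\adj g) i j).
Proof.
under eq_fun do rewrite mxE; apply: polyfun_mul.
  rewrite -(rmorph_sign emb); exact: polyfun_scalar.
apply: polyfun_det => a b; under eq_fun do rewrite !mxE.
exact: polyfun_coord.
Qed.

(* Clearing denominators: [f (x^-1)] is a polynomial in [x] up to a power of the determinant. *)
Lemma polyfun_invmx f : polyfun S f ->
  exists (m : nat) (h : 'M[E]_d -> E), polyfun S h /\
    forall x, x \in unitmx -> h x = \det x ^+ m * f (invmx x).
Proof.
have hdet : polyfun S (fun x => \det x) by apply: polyfun_det; exact: polyfun_coord.
elim=> [c hc|i j|f1 f2 _ [m1 [h1 [p1 e1]]] _ [m2 [h2 [p2 e2]]]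
       |f1 f2 _ [m1 [h1 [p1 e1]]] _ [m2 [h2 [p2 e2]]]].
- exists 0, (fun=> c); split=> [|x _]; first exact: polyfun_const.
  by rewrite mul1r.
- exists 1, (fun x => (\adj x) i j); split=> [|x ux]; first exact: polyfun_adj.
  by rewrite /invmx ux !mxE mulrA divrr ?mul1r.
- exists (m1 + m2), (fun x => \det x ^+ m2 * h1 x + \det x ^+ m1 * h2 x); split.
    by apply: polyfun_add; apply: polyfun_mul => //; exact: polyfun_exp.
  by move=> x ux; rewrite e1 // e2 // mulrDr !mulrA -!exprD [(m2 + m1)%N]addnC.
- exists (m1 + m2), (fun x => h1 x * h2 x); split; first exact: polyfun_mul.
  by move=> x ux; rewrite e1 // e2 // exprD mulrACA.
Qed.

(* Homogenisation by the quadratic function [c]: if [x = u y] with [c y = 1],  *)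
(* then [u ^+ 2 = c x], and [f y] becomes polynomial in [x] up to the sign     *)
(* ambiguity of [u].                                                           *)
Lemma polyfun_homogenize f (c : 'M[E]_d -> E) : polyfun S c ->
  (forall u x, c (u *: x) = u ^+ 2 * c x) ->
  polyfun S f ->
  exists (m : nat) (h0 h1 : 'M[E]_d -> E), [/\ polyfun S h0, polyfun S h1 &
    forall u y, c y = 1 -> f y * u ^+ (m.*2.+1) = u * h0 (u *: y) + h1 (u *: y)].
Proof.
move=> pc hc.
have hx u y : c y = 1 -> u ^+ 2 = c (u *: y) by move=> cy; rewrite hc cy mulr1.
have h0 : polyfun S (fun=> 0) by exact: (polyfun_nat 0).
elim=> [a ha|i j|f1 f2 _ [m1 [a1 [b1 [pa1 pb1 e1]]]] _ [m2 [a2 [b2 [pa2 pb2 e2]]]]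
       |f1 f2 _ [m1 [a1 [b1 [pa1 pb1 e1]]]] _ [m2 [a2 [b2 [pa2 pb2 e2]]]]].
- exists 0, (fun=> a), (fun=> 0); split=> // [|u y _]; first exact: polyfun_const.
  by rewrite addr0 mulrC.
- exists 0, (fun=> 0), (fun x => x i j); split=> // [|u y _]; first exact: polyfun_coord.
  by rewrite mulr0 add0r mxE mulrC.
(* Even powers of [u] are powers of [c x], which brings both summands to a common exponent. *)
- exists (m1 + m2), (fun x => c x ^+ m2 * a1 x + c x ^+ m1 * a2 x),
    (fun x => c x ^+ m2 * b1 x + c x ^+ m1 * b2 x); split.
  + by apply: polyfun_add; apply: polyfun_mul => //; exact: polyfun_exp.
  + by apply: polyfun_add; apply: polyfun_mul => //; exact: polyfun_exp.
  move=> u y cy; move: (e1 u y cy) (e2 u y cy).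
  rewrite -(hx u y cy) -!exprM !mul2n doubleD !exprS exprD => E1 E2.
  transitivity (u ^+ m2.*2 * (f1 y * (u * u ^+ m1.*2))
                + u ^+ m1.*2 * (f2 y * (u * u ^+ m2.*2))); first by ring.
  by rewrite E1 E2; ring.
(* Two odd exponents add up to an even one; a further factor [u] makes it odd again, and each
   [u ^+ 2] becomes [c x]. *)
- exists (m1 + m2).+1, (fun x => c x * (a1 x * a2 x) + b1 x * b2 x),
    (fun x => c x * (a1 x * b2 x + b1 x * a2 x)); split.
  + by do ?[apply: polyfun_add => // | apply: polyfun_mul => //].
  + by do ?[apply: polyfun_add => // | apply: polyfun_mul => //].
  move=> u y cy; move: (e1 u y cy) (e2 u y cy).
  rewrite -(hx u y cy) doubleS doubleD !exprS exprD expr0 => E1 E2.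
  transitivity (u * (f1 y * (u * u ^+ m1.*2)) * (f2 y * (u * u ^+ m2.*2))); first by ring.
  by rewrite E1 E2; ring.
Qed.

End PolynomialFunctions.

(** * Zariski closures of sets of rational matrices *)

Section ZariskiClosure.
Variables (k : fieldType) (Om : alg_closure k) (d : nat).
Implicit Types (S C : set 'M[Om]_d) (g x y : 'M[Om]_d).

Notation rational := (range (ac_emb Om)).

Lemma mx_evalD p q g : mx_eval (p + q) g = mx_eval p g + mx_eval q g.
Proof. by rewrite /mx_eval !rmorphD. Qed.

Lemma mx_evalM p q g : mx_eval (p * q) g = mx_eval p g * mx_eval q g.
Proof. by rewrite /mx_eval !rmorphM. Qed.

Lemma mx_evalC c g : mx_eval c%:MP g = ac_emb Om c.
Proof. by rewrite /mx_eval map_mpolyC mevalC. Qed.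

Lemma mx_evalX i g : mx_eval 'X_i g = mxvec g 0 i.
Proof. by rewrite /mx_eval map_mpolyX mevalXU. Qed.

Lemma mx_eval_rational p (a : 'M[k]_d) :
  mx_eval p (map_mx (ac_emb Om) a) = ac_emb Om p.@[fun i => mxvec a 0 i].
Proof.
elim/mpolyind: p => [|c m p _ _ IH].
  by rewrite /mx_eval !rmorph0.
rewrite mx_evalD IH mevalD rmorphD -mul_mpolyC mx_evalM mx_evalC mevalM mevalC rmorphM.
congr (_ * _ + _); rewrite /mx_eval map_mpolyX !mevalX rmorph_prod.
by apply: eq_bigr => i _; rewrite rmorphXn -map_mxvec mxE.
Qed.

Lemma polyfun_mx_eval p : polyfun rational (@mx_eval k Om d p).
Proof.
elim/mpolyind: p => [|c m p _ _ IH].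
  apply: eq_polyfun (polyfun_scalar _ (ac_emb Om) 0) => g.
  by rewrite -mpolyC0 mx_evalC.
apply: (@eq_polyfun _ _ _ _ (fun g => ac_emb Om c * mx_eval 'X_[m] g + mx_eval p g)).
  by move=> g; rewrite mx_evalD -mul_mpolyC mx_evalM mx_evalC.
apply: polyfun_add => //; apply: polyfun_mul; first exact: polyfun_scalar.
apply: (@eq_polyfun _ _ _ _ (fun g => \prod_(i < d * d) mxvec g 0 i ^+ m i)).
  by move=> g; rewrite /mx_eval map_mpolyX mevalX.
apply: polyfun_prod => i; apply: polyfun_exp.
case/mxvec_indexP: i => i j; apply: eq_polyfun (polyfun_coord _ i j) => g.
exact: mxvecE.
Qed.

Lemma mx_eval_polyfun f : polyfun rational f ->
  exists p, forall g, @mx_eval k Om d p g = f g.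
Proof.
elim=> [_ [c _ <-]|i j|f1 f2 _ [p1 e1] _ [p2 e2]|f1 f2 _ [p1 e1] _ [p2 e2]].
- by exists c%:MP => g; rewrite mx_evalC.
- by exists 'X_(mxvec_index i j) => g; rewrite mx_evalX mxvecE.
- by exists (p1 + p2) => g; rewrite mx_evalD e1 e2.
- by exists (p1 * p2) => g; rewrite mx_evalM e1 e2.
Qed.

(** The closure in the space of all matrices, singular ones included; [zariski_closureE] relates it
    to the closure relative to [X]. *)
Definition closure_of S : set 'M[Om]_d :=
  [set g | forall f, polyfun rational f -> (forall x, S x -> f x = 0) -> f g = 0].

Lemma subset_closure_of S : S `<=` closure_of S.
Proof. by move=> x Sx f _; apply. Qed.

Lemma zariski_closedP C : zariski_closed C <-> closure_of C `<=` C.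
Proof.
split=> [[P ->] g gC p Pp|sub].
  by apply: (gC (mx_eval p)) => [|x]; [exact: polyfun_mx_eval | apply].
exists [set p | forall x, C x -> mx_eval p x = 0]; apply/seteqP; split=> [g Cg p|g gP].
  exact.
apply: sub => f /mx_eval_polyfun [p pf] fC; rewrite -pf; apply: gP => x Cx.
by rewrite pf fC.
Qed.

Lemma closure_of_min S C : zariski_closed C -> S `<=` C -> closure_of S `<=` C.
Proof.
move=> /zariski_closedP CC SC g gS; apply: CC => f pf fC.
by apply: gS => // x /SC; exact: fC.
Qed.

Lemma zariski_closed_closure_of S : zariski_closed (closure_of S).
Proof.
apply/zariski_closedP => g gC f pf fS; apply: gC => // x; exact.
Qed.

Lemma zariski_closureE X S : zariski_closure X S = X `&` closure_of S.
Proof.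
apply/seteqP; split=> g [Xg gS]; split=> //.
  by apply: gS; [exact: zariski_closed_closure_of | exact: subset_closure_of].
by move=> C CC SC; apply: closure_of_min gS.
Qed.

Lemma zariski_closed_zeros f : polyfun rational f ->
  zariski_closed [set g : 'M[Om]_d | f g = 0].
Proof. by move=> pf; apply/zariski_closedP => g; apply. Qed.

Lemma zariski_closed_bigcap (I : Type) (Z : I -> set 'M[Om]_d) :
  (forall i, zariski_closed (Z i)) -> zariski_closed (\bigcap_i Z i).
Proof.
move=> ZC; apply/zariski_closedP => g gZ i _.
have /zariski_closedP := ZC i; apply => f pf fZ.
by apply: gZ => // x xZ; apply: fZ; exact: xZ.
Qed.

(** If [g] is not in [C1], some [f1] vanishing on [C1] is nonzero at [g]. For each [f2] vanishing on
    [C2], the product [f1 * f2] vanishes on the union, hence at [g], so [f2 g = 0]. *)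
Lemma zariski_closedU C1 C2 :
  zariski_closed C1 -> zariski_closed C2 -> zariski_closed (C1 `|` C2).
Proof.
move=> /zariski_closedP h1 /zariski_closedP h2; apply/zariski_closedP => g gC.
case: (pselect (C1 g)) => [c1|n1]; first by left.
right; apply: h2 => f2 p2 z2.
have [f1 [p1 z1 nz1]] : exists f, [/\ polyfun rational f,
    forall x, C1 x -> f x = 0 & f g != 0].
  apply: contra_notP n1 => nf; apply: h1 => f pf fz.
  by apply/eqP; apply: contra_notT nf => nz; exists f.
have /eqP : f1 g * f2 g = 0.
  apply: (gC (fun x => f1 x * f2 x)) => [|x [/z1 ->|/z2 ->]]; last by rewrite mulr0.
    exact: polyfun_mul.
  by rewrite mul0r.
by rewrite mulf_eq0 (negPf nz1) => /eqP.
Qed.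

Lemma zariski_closed0 : zariski_closed (set0 : set 'M[Om]_d).
Proof.
apply/zariski_closedP => g g0.
have /eqP : (1 : Om) = 0 by apply: (g0 (fun=> 1)) => //; exact: (polyfun_nat _ _ 1).
by rewrite oner_eq0.
Qed.

Lemma zariski_closed_bigcup_lt N (Z : nat -> set 'M[Om]_d) :
  (forall i, zariski_closed (Z i)) ->
  zariski_closed [set g : 'M[Om]_d | exists2 i, (i < N)%N & Z i g].
Proof.
move=> ZC; elim: N => [|N IH].
  suff -> : [set g : 'M[Om]_d | exists2 i, (i < 0)%N & Z i g] = set0 by exact: zariski_closed0.
  by apply/seteqP; split=> [g []|g []].
suff -> : [set g : 'M[Om]_d | exists2 i, (i < N.+1)%N & Z i g]
    = [set g : 'M[Om]_d | exists2 i, (i < N)%N & Z i g] `|` Z N by exact: zariski_closedU.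
apply/seteqP; split=> g.
  by move=> [j]; rewrite ltnS leq_eqVlt => /orP[/eqP -> | ltjN] Zj; [right | left; exists j].
by case=> [[j ltjN Zj]|ZN]; [exists j => //; exact: ltnW | exists N].
Qed.

Lemma zariski_closed_preimage C (phi : 'M[Om]_d -> 'M[Om]_d) :
  (forall i j, polyfun rational (fun g => phi g i j)) ->
  zariski_closed C -> zariski_closed (phi @^-1` C).
Proof.
move=> pphi /zariski_closedP CC; apply/zariski_closedP => g gC; apply: CC => f pf fC.
by apply: (gC (fun x => f (phi x))) => [|x]; [exact: polyfun_comp | exact: fC].
Qed.

Lemma polyfun_mulmx (phi1 phi2 : 'M[Om]_d -> 'M[Om]_d) (s : set Om) :
  s 0 ->
  (forall i j, polyfun s (fun g => phi1 g i j)) ->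
  (forall i j, polyfun s (fun g => phi2 g i j)) ->
  forall i j, polyfun s (fun g => (phi1 g *m phi2 g) i j).
Proof.
move=> s0 p1 p2 i j; under eq_fun do rewrite mxE.
elim: (index_enum _) => [|m r IH].
  by under eq_fun do rewrite big_nil; exact: polyfun_const.
under eq_fun do rewrite big_cons.
by apply: polyfun_add => //; exact: polyfun_mul.
Qed.

(** * Closures of sets of rational points, tested with coefficients in [Om] *)

Section RationalPoints.
Variable T : set 'M[k]_d.
Let S := [set map_mx (ac_emb Om) a | a in T].

Lemma polyfun_decompose f : polyfun setT f ->
  exists s : seq (Om * {mpoly k[d * d]}),
    forall g, f g = \sum_(cp <- s) cp.1 * mx_eval cp.2 g.
Proof.
elim=> [c _|i j|f1 f2 _ [s1 e1] _ [s2 e2]|f1 f2 _ [s1 e1] _ [s2 e2]].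
- by exists [:: (c, 1)] => g; rewrite big_seq1 /= mx_evalC rmorph1 mulr1.
- by exists [:: (1, 'X_(mxvec_index i j))] => g; rewrite big_seq1 /= mx_evalX mxvecE mul1r.
- by exists (s1 ++ s2) => g; rewrite big_cat /= e1 e2.
exists [seq (a.1 * b.1, a.2 * b.2) | a <- s1, b <- s2] => g.
rewrite big_allpairs_dep /= e1 e2 mulr_suml; apply: eq_bigr => a _.
rewrite mulr_sumr; apply: eq_bigr => b _; rewrite mx_evalM; ring.
Qed.

(* Induction on the number of terms: a value [emb] of one of the polynomials at *)
(* a rational point eliminates one of the coefficients.                         *)
Lemma linear_combination_vanishes (s : seq (Om * {mpoly k[d * d]})) :
  (forall x, S x -> \sum_(cp <- s) cp.1 * mx_eval cp.2 x = 0) ->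
  forall g, closure_of S g -> \sum_(cp <- s) cp.1 * mx_eval cp.2 g = 0.
Proof.
have [m] := ubnP (size s); elim: m s => // m IH [|[c p] s] /=.
  by move=> _ _ g _; rewrite big_nil.
rewrite ltnS => sm sS g gS; rewrite big_cons /=.
have [pz|] := pselect (forall x, S x -> mx_eval p x = 0).
  rewrite (gS _ (polyfun_mx_eval p) pz) mulr0 add0r; apply: IH => // x Sx.
  by have := sS x Sx; rewrite big_cons /= pz // mulr0 add0r.
move=> /existsNP[_ /not_implyP[[a Ta <-] /eqP nz]].
pose x := map_mx (ac_emb Om) a.
(* The scalar [t q] lies in [k] and makes [q - t q *: p] vanish at [x]. Solving the relation at [x]
   for [c] turns the combination into one of these differences, with one term fewer. *)
pose t (q : {mpoly k[d * d]}) := q.@[fun i => mxvec a 0 i] / p.@[fun i => mxvec a 0 i].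
have tE q : ac_emb Om (t q) = mx_eval q x / mx_eval p x.
  by rewrite !mx_eval_rational -fmorphV -rmorphM.
pose s' := [seq (cp.1, cp.2 - (t cp.2) *: p) | cp <- s].
have cE : c = - \sum_(cp <- s) cp.1 * (mx_eval cp.2 x / mx_eval p x).
  have Sx : S x by exists a.
  have := sS x Sx; rewrite big_cons /= => /eqP; rewrite addr_eq0 => /eqP e.
  apply: (mulIf nz); rewrite e mulNr mulr_suml; congr (- _).
  by apply: eq_bigr => b _; rewrite mulrA divfK.
have s'E y : c * mx_eval p y + \sum_(cp <- s) cp.1 * mx_eval cp.2 y
    = \sum_(cp <- s') cp.1 * mx_eval cp.2 y.
  rewrite big_map cE mulNr mulr_suml -sumrN -big_split /=; apply: eq_bigr => b _.
  rewrite -scaleNr -mul_mpolyC mx_evalD mx_evalM mx_evalC rmorphN tE; ring.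
rewrite s'E; apply: IH => // [|y Sy]; first by rewrite size_map.
by rewrite -s'E; have := sS y Sy; rewrite big_cons.
Qed.

(** Enlarging the field of coefficients from [k] to [Om] does not shrink the closure of a set of
    [k]-points. *)
Lemma polyfun_vanishes f : polyfun setT f -> (forall x, S x -> f x = 0) ->
  forall g, closure_of S g -> f g = 0.
Proof.
move=> /polyfun_decompose[s fE] fS g gS; rewrite fE.
by apply: linear_combination_vanishes gS => x Sx; rewrite -fE fS.
Qed.

Hypothesis T_unit : forall a, T a -> a \in unitmx.
Hypothesis T_mul : forall a b, T a -> T b -> T (a *m b).
Hypothesis T_inv : forall a, T a -> T (invmx a).

(** A power of the determinant times [f (invmx x)] is a polynomial that vanishes on [S]; at an
    invertible [g] the power can be cancelled. *)
Lemma closure_of_invmx g : g \in unitmx -> closure_of S g -> closure_of S (invmx g).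
Proof.
move=> ug gS f pf fS; have [m [h [ph hE]]] := polyfun_invmx pf.
have : h g = 0.
  apply: gS => // _ [a Ta <-]; rewrite hE ?map_unitmx ?T_unit // -map_invmx.
  by rewrite fS ?mulr0 //; exists (invmx a) => //; exact: T_inv.
rewrite hE // => /eqP; rewrite mulf_eq0 expf_eq0 => /orP[/andP[_ /eqP d0]|/eqP//].
by move: ug; rewrite unitmxE d0 unitr0.
Qed.

Lemma closure_of_mull a g : T a -> closure_of S g ->
  closure_of S (map_mx (ac_emb Om) a *m g).
Proof.
move=> Ta gS f pf fS.
apply: (gS (fun x => f (map_mx (ac_emb Om) a *m x))) => [|_ [b Tb <-]].
  apply: polyfun_comp pf _ => i j; apply: polyfun_mulmx => //.
  - by exists 0 => //; rewrite rmorph0.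
  - by move=> i' j'; apply: polyfun_const; exists (a i' j') => //; rewrite mxE.
  - exact: polyfun_coord.
by rewrite -map_mxM fS //; exists (a *m b) => //; exact: T_mul.
Qed.

(** By [closure_of_mull], the function sending [x] to [f (x *m h)] vanishes at the rational points.
    Its coefficients involve the entries of [h], which need not be in [k], whence
    [polyfun_vanishes]. *)
Lemma closure_of_mulmx g h : closure_of S g -> closure_of S h -> closure_of S (g *m h).
Proof.
move=> gS hS f pf fS; apply: (@polyfun_vanishes (fun x => f (x *m h))) gS.
  apply: polyfun_comp; first exact: polyfun_subset pf.
  move=> i j; apply: polyfun_mulmx => //; first exact: polyfun_coord.
  by move=> i' j'; exact: polyfun_const.
by move=> _ [a Ta <-]; apply: (closure_of_mull Ta hS).
Qed.

End RationalPoints.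
End ZariskiClosure.

(** * Square roots and approximation in p-adic fields *)

Section Ultrametric.
Variables (R : realType) (E : fieldType) (w : E -> R).
Hypothesis hw : ultrametric_abs w.

Let w_ge0 : forall x, 0 <= w x. Proof. by case: hw. Qed.
Let w_eq0 : forall x, w x = 0 <-> x = 0. Proof. by case: hw. Qed.
Let wM : forall x y, w (x * y) = w x * w y. Proof. by case: hw. Qed.
Let wD : forall x y, w (x + y) <= Num.max (w x) (w y). Proof. by case: hw. Qed.

Lemma ultrametric0 : w 0 = 0. Proof. exact/w_eq0. Qed.

Lemma ultrametric_gt0 x : x != 0 -> 0 < w x.
Proof.
by move=> x0; rewrite lt_neqAle w_ge0 andbT eq_sym; apply: contraNneq x0 => /w_eq0 ->.
Qed.

Lemma ultrametric1 : w 1 = 1.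
Proof.
have w1 : 0 < w 1 by exact: ultrametric_gt0 (oner_neq0 _).
by apply: (mulfI (lt0r_neq0 w1)); rewrite -wM !mulr1.
Qed.

Lemma ultrametricX x n : w (x ^+ n) = w x ^+ n.
Proof. by elim: n => [|n IH]; rewrite ?expr0 ?ultrametric1 // !exprS wM IH. Qed.

Lemma ultrametricN x : w (- x) = w x.
Proof.
suff wN1 : w (-1) = 1 by rewrite -mulN1r wM wN1 mul1r.
have /eqP : w (-1) ^+ 2 = 1 by rewrite -ultrametricX sqrrN expr1n ultrametric1.
rewrite sqrf_eq1 => /orP[/eqP//|/eqP e].
by have := w_ge0 (-1); rewrite e oppr_ge0 ler10.
Qed.

Lemma ultrametricV x : w x^-1 = (w x)^-1.
Proof.
have [->|x0] := eqVneq x 0; first by rewrite invr0 ultrametric0 invr0.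
have wx : w x != 0 by rewrite gt_eqF // ultrametric_gt0.
by apply: (mulfI wx); rewrite -wM !divff // ultrametric1.
Qed.

Lemma ultrametric_le e x y : w x <= e -> w y <= e -> w (x + y) <= e.
Proof. by move=> hx hy; apply: le_trans (wD x y) _; rewrite ge_max hx. Qed.

Lemma ultrametric_sub_le e x y : w x <= e -> w y <= e -> w (x - y) <= e.
Proof. by move=> hx hy; apply: ultrametric_le => //; rewrite ultrametricN. Qed.

Lemma ultrametric_subC x y : w (x - y) = w (y - x).
Proof. by rewrite -ultrametricN opprB. Qed.

Lemma ultrametric_nat n : w n%:R <= 1.
Proof.
elim: n => [|n IH]; first by rewrite ultrametric0 ler01.
by rewrite -natr1; apply: ultrametric_le => //; rewrite ultrametric1.
Qed.

Lemma ultrametric_int (z : int) : w z%:~R <= 1.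
Proof.
by case: z => n; rewrite ?NegzE ?rmorphN /= ?ultrametricN -pmulrn; exact: ultrametric_nat.
Qed.

Lemma ultrametric_close1 x e : e < 1 -> w (x - 1) <= e -> w x = 1.
Proof.
move=> e1 hx; apply/eqP; rewrite eq_le; apply/andP; split.
  rewrite -[x](subrK 1); apply: ultrametric_le; last by rewrite ultrametric1.
  by apply: le_trans hx (ltW e1).
rewrite leNgt; apply/negP => x1.
have : w (x - (x - 1)) < 1.
  apply: le_lt_trans (wD _ _) _; rewrite gt_max x1 ultrametricN /=.
  exact: le_lt_trans hx e1.
by rewrite subKr ultrametric1 ltxx.
Qed.

Lemma ultrametric_expB x y n : w x <= 1 -> w y <= 1 -> w (x ^+ n - y ^+ n) <= w (x - y).
Proof.
move=> hx hy; elim: n => [|n IH]; first by rewrite !expr0 subrr ultrametric0.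
have -> : x ^+ n.+1 - y ^+ n.+1 = x * (x ^+ n - y ^+ n) + (x - y) * y ^+ n.
  by rewrite !exprS; ring.
apply: ultrametric_le; rewrite wM.
  by rewrite -[leRHS]mul1r ler_pM.
by rewrite -[leRHS]mulr1 ler_pM // ultrametricX exprn_ile1.
Qed.

Lemma ultrametric_eq0 x : (forall e, 0 < e -> w x < e) -> x = 0.
Proof.
by move=> h; apply/w_eq0/eqP; rewrite eq_le w_ge0 andbT leNgt; apply/negP => /h; rewrite ltxx.
Qed.

End Ultrametric.

Section PadicField.
Variables (R : realType) (l : nat) (Ql : padic_field R l).
Hypothesis pl : prime l.
Local Notation N := (@cp_norm _ _ _ Ql).

Let um : ultrametric_abs (@cp_norm _ _ _ Ql) := @cp_ultrametric _ _ _ Ql.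
Let lgt0 : 0 < (l%:R : R). Proof. by rewrite ltr0n prime_gt0. Qed.
Let wM : forall x y, N (x * y) = N x * N y. Proof. by case: um. Qed.
Let w_ge0 : forall x, 0 <= N x. Proof. by case: um. Qed.

Lemma cp_norm_nat n : (0 < n)%N -> N n%:R = l%:R ^- logn l n.
Proof.
move=> n0; rewrite -(rmorph_nat (cp_emb Ql)) cp_extends /padic_norm.
rewrite pnatr_eq0 gtn_eqF //= -[n%:R]/((n%:Z)%:Q) denq_int numq_int /= logn1 sub0r.
by rewrite -exprnN.
Qed.

Lemma cp_norm_dvd m n : (l ^ m %| n)%N -> N n%:R <= l%:R ^- m.
Proof.
move=> /dvdnP[q ->]; rewrite natrM natrX wM ultrametricX //.
rewrite (cp_norm_nat (prime_gt0 pl)) logn_prime // eqxx expr1 exprVn.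
rewrite -[leRHS]mul1r ler_wpM2r ?ultrametric_nat //.
by rewrite invr_ge0 exprn_ge0 // ltW.
Qed.

Lemma Ql_natr_neq0 n : (0 < n)%N -> (n%:R : Ql) != 0.
Proof.
move=> n0; apply: contra_eq_neq (cp_norm_nat n0) => ->.
by rewrite ultrametric0 // eq_sym invr_neq0 // expf_neq0 // gt_eqF.
Qed.

(** The natural numbers are dense in $\mathbb{Z}_l$: a nearby rational is [l]-integral, and its
    denominator can be inverted modulo [l ^ m]. *)
Lemma nat_approximation (x : Ql) m : N x <= 1 -> exists b : nat, N (x - b%:R) <= l%:R ^- m.
Proof.
move=> x1; have lm : 0 < (l%:R ^- m : R) by rewrite invr_gt0 exprn_gt0.
have [q hq] := cp_dense x lm.
have q1 : padic_norm R l q <= 1.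
  rewrite -(cp_extends Ql) -[cp_emb Ql q](subKr x); apply: ultrametric_sub_le => //.
  apply: le_trans (ltW hq) _; rewrite invf_le1 ?exprn_gt0 //.
  by rewrite exprn_ege1 // ler1n prime_gt0.
(* If [l] divided the denominator it could not divide the numerator, and [q] would have norm greater
   than 1. *)
have lden : ~~ (l %| `|denq q|)%N.
  apply/negP => ld.
  have ln : ~~ (l %| `|numq q|)%N.
    apply/negP => ln; have := coprime_num_den q.
    rewrite /coprime => /eqP g1.
    have : (l %| 1)%N by rewrite -g1 dvdn_gcd ln ld.
    by rewrite dvdn1 => /eqP l1; move: pl; rewrite l1.
  move: q1; rewrite /padic_norm; case: eqP => [q0|_].
    by move: ld; rewrite q0 /= dvdn1 => /eqP l1; move: pl; rewrite l1.
  rewrite [logn l `|numq q|]lognE (negPf ln) !andbF subr0.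
  have : (0 < logn l `|denq q|)%N by rewrite logn_gt0 mem_primes pl absz_gt0 denq_eq0.
  case: (logn l _) => // t _; apply/negP; rewrite -ltNge.
  by rewrite -exprnP exprn_egt1 // ltr1n prime_gt1.
have den0 : (0 < `|denq q|)%N by rewrite absz_gt0 denq_eq0.
have Nden : N `|denq q|%:R = 1.
  by rewrite cp_norm_nat // lognE (negPf lden) !andbF expr0 invr1.
have : coprime `|denq q| (l ^ m) by rewrite coprimeXr // coprime_sym prime_coprime.
move=> /(coprimeP _ den0)[[u1 u2] /= bez].
have {bez} : (u1 * `|denq q| = 1 + u2 * l ^ m)%N.
  by rewrite addnC -bez subnKC // ltnW // -subn_gt0 bez.
move=> /(congr1 (fun n => n%:R : Ql)); rewrite natrM natrD natrM natrX => bez.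
have := divz_eq (numq q) (l ^ m)%N; set z := (_ %/ _)%Z; set c := (_ %% _)%Z.
move=> /(congr1 (fun n => n%:~R : Ql)).
rewrite intrD intrM /= -pmulrn natrX => numE.
have c0 : 0 <= c by rewrite modz_ge0 // -lt0n expn_gt0 prime_gt0.
(* Here [c] is the numerator modulo [l ^ m] and [u1] an inverse of the denominator modulo
   [l ^ m]. *)
move: c0 numE; case: c => // c _ numE; exists (c * u1)%N.
have -> : x - (c * u1)%:R
    = (x - cp_emb Ql q) + (cp_emb Ql q - (c * u1)%:R) by ring.
apply: ultrametric_le => //; first exact: ltW.
have d0 : (`|denq q|%:R : Ql) != 0 by exact: Ql_natr_neq0.
have -> : cp_emb Ql q - (c * u1)%:R
    = l%:R ^+ m * (z - c%:Z * u2%:Z)%:~R / `|denq q|%:R.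
  have qE : cp_emb Ql q = (numq q)%:~R / `|denq q|%:R.
    rewrite -[q in LHS]divq_num_den fmorph_div !rmorph_int -[in LHS]absz_denq.
    by rewrite -pmulrn.
  apply: (mulIf d0); rewrite divfK // mulrBl qE divfK //.
  by rewrite natrM -mulrA bez numE rmorphB rmorphM /= -!pmulrn; ring.
rewrite !wM ultrametricV // Nden invr1 mulr1 -natrX.
rewrite -[leRHS]mulr1 ler_pM // ?cp_norm_dvd //.
exact: ultrametric_int.
Qed.

(** With [u = 1 + y] and [s = t - 1], the equation reads [y = (s - y ^+ 2) / 2]. The right-hand side
    maps the ball of radius [r], the norm of 2 divided by [l], to itself and contracts it by
    [1 / l]; completeness yields a fixed point. *)
Lemma padic_sqrt (t : Ql) : N (t - 1) <= N 4%:R / l%:R ->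
  exists2 u, u ^+ 2 = t & N (u - 1) <= l%:R^-1.
Proof.
set s := t - 1; set c := N 2%:R; set r := c / l%:R => hs.
have two0 : (2%:R : Ql) != 0 by exact: Ql_natr_neq0.
have c0 : 0 < c by exact: ultrametric_gt0.
have c1 : c <= 1 by exact: ultrametric_nat.
have li0 : 0 < (l%:R^-1 : R) by rewrite invr_gt0.
have li1 : (l%:R^-1 : R) <= 1 by rewrite invf_le1 // ler1n prime_gt0.
have r0 : 0 < r by rewrite mulr_gt0.
have rl : r <= l%:R^-1 by rewrite -[leRHS]mul1r ler_pM // ltW.
have r1 : r <= 1 by exact: le_trans rl li1.
have hsr : N s <= r * c.
  by apply: le_trans hs _; rewrite -[4%N]/(2 * 2)%N natrM wM mulrAC.
pose T z := (s - z ^+ 2) / 2%:R.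
have div2 x e : N x <= e * c -> N (x / 2%:R) <= e.
  by move=> hx; rewrite wM ultrametricV // ler_pdivrMr.
have Tle z : N z <= r -> N (T z) <= r.
  move=> hz; apply: div2; apply: ultrametric_sub_le => //.
  rewrite ultrametricX // expr2; apply: ler_pM => //.
  by apply: le_trans hz _; rewrite -[leRHS]mulr1 ler_pM // ltW.
have Tcontract y z : N y <= r -> N z <= r -> N (T y - T z) <= l%:R^-1 * N (y - z).
  move=> hy hz.
  have -> : T y - T z = (z - y) * (z + y) / 2%:R by rewrite /T -mulrBl; congr (_ / _); ring.
  apply: div2; rewrite wM [N (z - y)]ultrametric_subC // [leRHS]mulrAC [leRHS]mulrC.
  apply: ler_pM => //; rewrite mulrC; exact: ultrametric_le.
pose z_ i := iter i T 0.
have zr i : N (z_ i) <= r by elim: i => [|i IH]; [rewrite ultrametric0 // ltW | exact: Tle].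
have zstep i : N (z_ i.+1 - z_ i) <= l%:R^-1 ^+ i.
  elim: i => [|i IH]; first by rewrite subr0 expr0; apply: le_trans (zr 1%N) r1.
  by apply: (le_trans (Tcontract _ _ (zr i.+1) (zr i))); rewrite exprS ler_pM // ltW.
have zcauchy i k : N (z_ (i + k)%N - z_ i) <= l%:R^-1 ^+ i.
  elim: k => [|k IH]; first by rewrite addn0 subrr ultrametric0 // exprn_ge0 // ltW.
  have -> : z_ (i + k.+1)%N - z_ i
     = (z_ (i + k).+1 - z_ (i + k)%N) + (z_ (i + k)%N - z_ i).
    by rewrite addnS; ring.
  apply: ultrametric_le => //; apply: le_trans (zstep _) _.
  by rewrite exprD -[leRHS]mulr1 ler_wpM2l ?exprn_ge0 ?exprn_ile1 // ltW.
have [|y ylim] := @cp_complete _ _ _ Ql z_.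
  move=> e e0; exists (Num.bound e^-1) => i j.
  have le_e i0 : (Num.bound e^-1 <= i0)%N -> (l%:R^-1 ^+ i0 : R) < e.
    move=> hi; rewrite exprVn invf_plt ?posrE ?exprn_gt0 //.
    apply: lt_le_trans (upper_nthrootP hi) _.
    by rewrite lerXn2r ?nnegrE ?ler0n // ler_nat prime_gt1.
  have [ij|/ltnW ij] := leqP i j => hi hj.
    rewrite ultrametric_subC // -(subnKC ij); exact: le_lt_trans (zcauchy _ _) (le_e _ hi).
  rewrite -(subnKC ij); exact: le_lt_trans (zcauchy _ _) (le_e _ hj).
have yr : N y <= r.
  have [i0 hi] := ylim r r0; have := hi i0 (leqnn _) => /ltW hyi.
  by rewrite -[y](subrK (z_ i0)); apply: ultrametric_le; rewrite // ultrametric_subC.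
(* Replacing [s] by its expression in two consecutive iterates leaves an error controlled by their
   distances to [y]. *)
have fix_y : y ^+ 2 + 2%:R * y = s.
  apply/eqP; rewrite -subr_eq0; apply/eqP; apply: (ultrametric_eq0 um) => e e0.
  have [i0 hi] := ylim e e0.
  have zE : s = z_ i0 ^+ 2 + 2%:R * z_ i0.+1.
    by rewrite /z_ iterS -/(z_ i0) /T mulrC divfK // addrC subrK.
  have -> : y ^+ 2 + 2%:R * y - s
      = (y - z_ i0) * (y + z_ i0) + 2%:R * (y - z_ i0.+1) by rewrite zE; ring.
  have h0 := hi i0 (leqnn _); have h1 := hi i0.+1 (leqnSn _).
  apply: le_lt_trans (_ : Num.max (N (z_ i0 - y)) (N (z_ i0.+1 - y)) < e).
    case: um => _ _ _ wD; apply: le_trans (wD _ _) _.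
    rewrite !wM [N (y - _)]ultrametric_subC // [N (y - z_ i0.+1)]ultrametric_subC //.
    rewrite ge_max !le_max; apply/andP; split; apply/orP; [left|right].
      rewrite -[leRHS]mulr1 ler_pM //; apply: ultrametric_le => //; exact: le_trans r1.
    by rewrite -[leRHS]mul1r ler_pM.
  by rewrite gt_max h0.
exists (1 + y).
  by rewrite sqrrD expr1n mul1r -addrA -mulr_natl [_ + y ^+ 2]addrC fix_y /s addrC subrK.
by rewrite addrAC subrr add0r; exact: le_trans yr rl.
Qed.

End PadicField.

(** * Galois theory *)

Lemma closed_field_prim_root (F : closedFieldType) n :
  (n%:R : F) != 0 -> exists z : F, n.-primitive_root z.
Proof.
move=> nF; have n_gt0 : (0 < n)%N by case: n nF => //; rewrite eqxx.
have [r Dp] := closed_field_poly_normal ('X^n - 1 : {poly F}).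
rewrite (monicP (monicXnsubC _ n_gt0)) scale1r in Dp.
have /hasP[z _ zP] : has n.-primitive_root r.
  apply: cyclic.has_prim_root => //.
  - by apply/allP => z; rewrite -root_prod_XsubC -Dp.
  - by rewrite -separable_prod_XsubC -Dp separable_Xn_sub_1.
  - by rewrite -ltnS -(size_prod_XsubC r id) -Dp size_XnsubC.
by exists z.
Qed.

Section AbsoluteGaloisGroup.
Variables (K : fieldType) (Kbar : alg_closure K).
Implicit Types sigma tau : absGal Kbar.

Lemma absGal_inv sigma : exists tau : absGal Kbar,
  (forall x, tau (sigma x) = x) /\ (forall x, sigma (tau x) = x).
Proof.
have [g gK Kg] := gal_bij sigma.
have gB : zmod_morphism g.
  by move=> x y; apply: (can_inj gK); rewrite rmorphB !Kg.
have gM : monoid_morphism g.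
  by split=> [|x y]; apply: (can_inj gK); rewrite ?rmorph1 ?rmorphM !Kg.
pose gAM := GRing.isZmodMorphism.Build _ _ g gB.
pose gMM := GRing.isMonoidMorphism.Build _ _ g gM.
pose gRM : {rmorphism Kbar -> Kbar} := HB.pack g gAM gMM.
have gfix x : gRM (ac_emb Kbar x) = ac_emb Kbar x.
  by apply: (can_inj gK); rewrite /= Kg gal_fix.
by exists (@AbsGal _ _ gRM (Bijective Kg gK) gfix).
Qed.

End AbsoluteGaloisGroup.

Section FiniteGalois.
Variables (K : fieldExtType rat) (Kbar : alg_closure K).
Variables (K0 : splittingFieldType K) (e0 : {rmorphism K0 -> Kbar}).
Hypothesis he0 : forall x : K, e0 x%:A = ac_emb Kbar x.
Implicit Types sigma tau : absGal Kbar.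

(** Normality: the conjugate of [e0 x] is a root of the minimal polynomial of [x], which splits in
    [K0], so it lies in the image of [e0]. *)
Lemma absGal_restriction sigma :
  exists g : gal_of {:K0}, forall x, sigma (e0 x) = e0 (g x).
Proof.
have stable x : exists y, e0 y = sigma (e0 x).
  have [r /eqP rE] := splitting_field_normal 1%AS x.
  have /polyOver1P[p pE] := minPolyOver 1%AS x.
  have h0 : map_poly e0 (minPoly 1%AS x) = map_poly (ac_emb Kbar) p.
    by rewrite pE -map_poly_comp; apply: eq_map_poly => a /=; rewrite he0.
  have : root (map_poly e0 (minPoly 1%AS x)) (sigma (e0 x)).
    have -> : map_poly e0 (minPoly 1%AS x)
        = map_poly sigma (map_poly e0 (minPoly 1%AS x)).
      rewrite h0 -[RHS]map_poly_comp; apply: eq_map_poly => a /=.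
      by rewrite gal_fix.
    by rewrite fmorph_root fmorph_root root_minPoly.
  rewrite rE rmorph_prod /=.
  have -> : \prod_(i <- r) map_poly e0 ('X - i%:P) = \prod_(z <- map e0 r) ('X - z%:P).
    by rewrite big_map; apply: eq_bigr => i _; rewrite rmorphB /= map_polyX map_polyC.
  by rewrite root_prod_XsubC => /mapP[y _ ->]; exists y.
pose f x := projT1 (cid (stable x)).
have fE x : e0 (f x) = sigma (e0 x) by exact: projT2 (cid (stable x)).
have e0_inj : injective e0 := fmorph_inj e0.
have fB : zmod_morphism f by move=> x y; apply: e0_inj; rewrite rmorphB /= !fE !rmorphB.
have fM : monoid_morphism f.
  by split=> [|x y]; apply: e0_inj; rewrite fE ?rmorph1 ?rmorphM // !fE.
have fZ : scalable f.
  move=> a x; apply: e0_inj; rewrite -mulr_algl fE rmorphM /= he0 rmorphM /= gal_fix.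
  by rewrite -mulr_algl rmorphM /= he0 fE.
pose fAM := GRing.isZmodMorphism.Build _ _ f fB.
pose fZM := GRing.isScalable.Build _ _ _ _ f fZ.
pose fL : {linear K0 -> K0} := HB.pack f fAM fZM.
have hf : kHom 1 {:K0} (linfun fL).
  apply/kHomP; split=> [x y _ _|x /vlineP[a ->]].
    by rewrite !lfunE /=; case: fM.
  by rewrite lfunE /= fZ; case: fM => ->.
have [g _ gE] := @kAut_to_gal _ _ 1%AS {:K0}%AS _ (etrans (kAutfE _ _) hf).
by exists g => x; rewrite -gE ?memvf // lfunE fE.
Qed.

(** The restrictions of [A] form a subgroup of the Galois group of [K0], closure under products
    being enough in a finite group. Its fixed field is [K], so by the Galois correspondence it is
    everything. *)
Lemma absGal_factorization (A : set (absGal Kbar)) :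
  A (Defs.gal_one Kbar) ->
  (forall sigma tau, A sigma -> A tau -> A (Defs.gal_mul sigma tau)) ->
  range e0 `&` fixed_field A `<=` range (ac_emb Kbar) ->
  forall sigma, exists tau, A tau /\ forall x, sigma (e0 x) = tau (e0 x).
Proof.
move=> A1 AM fixA sigma.
pose B := [set g : gal_of {:K0}%AS | `[< exists tau, A tau /\ forall x, tau (e0 x) = e0 (g x) >]]%SET.
have Bgroup : group_set B.
  apply/group_setP; split=> [|g h].
    rewrite inE; apply/asboolP; exists (Defs.gal_one Kbar); split=> // x /=.
    by rewrite gal_id.
  rewrite !inE => /asboolP[s [As sE]] /asboolP[t [At tE]]; apply/asboolP.
  (* The product in [gal_of] applies its left factor first, whereas [gal_mul] applies its right one
     first. *)
  exists (Defs.gal_mul t s); split=> [|x /=]; first exact: AM.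
  by rewrite galM ?memvf // sE tE.
have fixB : (fixedField (Group Bgroup) <= 1)%VS.
  apply/subvP => x /mem_fixedFieldP[_ xB].
  have [|y _ yE] := fixA (e0 x).
    split=> [|tau Atau]; first by exists x.
    have [g gE] := absGal_restriction tau.
    by rewrite gE xB // inE; apply/asboolP; exists tau.
  by apply/vlineP; exists y; apply: (fmorph_inj e0); rewrite he0.
have [g gE] := absGal_restriction sigma.
have : g \in Group Bgroup.
  rewrite -gal_fixedField; apply: (fintype.subsetP (galS _ fixB)).
  by rewrite gal_kHom ?sub1v // k1AHom.
rewrite inE => /asboolP[tau [Atau tauE]].
by exists tau; split=> // x; rewrite gE tauE.
Qed.

End FiniteGalois.

(** * The action on tensor powers of roots of unity *)

Section MuTensorKernel.
Variables (K : fieldType) (Kbar : alg_closure K) (N : nat) (n : int) (zeta : Kbar).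
Hypotheses (N_gt1 : (1 < N)%N) (prim : N.-primitive_root zeta).
Implicit Types sigma tau : absGal Kbar.

(** A primitive root decides the whole action, and a negative power is 1 exactly when the opposite
    power is. *)
Lemma mu_tensor_kernelP sigma :
  mu_tensor_kernel Kbar N n sigma <->
  exists a, sigma zeta = zeta ^+ a /\ (a ^ `|n| = 1 %[mod N])%N.
Proof.
have powE a : (a%:R : 'Z_N) ^ n = 1 <-> (a ^ `|n| = 1 %[mod N])%N.
  have natE b c : (b%:R : 'Z_N) = c%:R <-> (b = c %[mod N])%N.
    by rewrite -!val_Zp_nat //; split=> [->//|/val_inj].
  rewrite -(natE _ 1%N) natrX; case: n => m //=.
  rewrite NegzE -exprnN; split=> /eqP h; apply/eqP; move: h; by rewrite ?invr_eq1.
split=> [[a [aE an]]|[a [aE an]]].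
  by exists a; split; [apply: aE; exact: prim_expr_order | exact/powE].
exists a; split; last exact/powE.
by move=> z /(prim_rootP prim)[j ->]; rewrite rmorphXn /= aE -!exprM mulnC.
Qed.

Lemma mu_tensor_kernel_fix sigma : sigma zeta = zeta -> mu_tensor_kernel Kbar N n sigma.
Proof. by move=> h; apply/mu_tensor_kernelP; exists 1%N; rewrite exp1n expr1. Qed.

Lemma mu_tensor_kernel_mul sigma tau :
  mu_tensor_kernel Kbar N n sigma -> mu_tensor_kernel Kbar N n tau ->
  mu_tensor_kernel Kbar N n (Defs.gal_mul sigma tau).
Proof.
move=> /mu_tensor_kernelP[a [aE an]] /mu_tensor_kernelP[b [bE bn]].
apply/mu_tensor_kernelP; exists (a * b)%N; split=> /=.
  by rewrite bE rmorphXn /= aE exprM.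
by rewrite expnMn -modnMml an modnMml mul1n.
Qed.

Lemma mu_tensor_kernel_inv sigma tau : (forall x, tau (sigma x) = x) ->
  mu_tensor_kernel Kbar N n sigma -> mu_tensor_kernel Kbar N n tau.
Proof.
move=> tauK /mu_tensor_kernelP[a [aE an]].
have : tau zeta ^+ N = 1 by rewrite -rmorphXn /= prim_expr_order // rmorph1.
move=> /(prim_rootP prim)[b bE]; apply/mu_tensor_kernelP; exists b; split=> //.
have : (a * b = 1 %[mod N])%N.
  apply/eqP; rewrite -(eq_prim_root_expr prim) expr1 mulnC exprM -bE -rmorphXn /= -aE.
  by rewrite tauK.
move=> ab; rewrite -[in LHS](mul1n (b ^ _)%N) -modnMml -an modnMml -expnMn.
by rewrite -modnXm ab modnXm exp1n.
Qed.

End MuTensorKernel.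

Section CyclotomicCharacter.
Variables (R : realType) (K : fieldType) (Kbar : alg_closure K).
Variables (l : nat) (Ql : padic_field R l) (chi : absGal Kbar -> Ql) (n : int).
Hypotheses (pl : prime l) (chiP : is_cyclotomic_character chi).

(** The radius in [padic_sqrt] is that of $1+\bar l\,\mathbb{Z}_l$: 4 is a unit for odd [l], and for
    [l = 2] the radius is $2^{-2}/2 = 2^{-3}$. This is where $\bar l = 8$ comes from. *)
Lemma lbar_exponent :
  exists2 m, lbar l = (l ^ m)%N & (0 < m)%N /\ (cp_norm (4%:R : Ql) / l%:R = l%:R ^- m).
Proof.
rewrite /lbar; case: eqP => l2.
  exists 3%N; first by rewrite l2.
  by rewrite cp_norm_nat // [X in logn X]l2 -invfM -exprSr.
exists 1%N; rewrite ?expn1 //; split=> //.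
rewrite cp_norm_nat // lognE pl /=.
case: ifP => [|_]; last by rewrite expr0 invr1 mul1r expr1.
by rewrite -[4%N]/(2 ^ 2)%N Euclid_dvdX // dvdn_prime2 // andbT => /eqP.
Qed.

(** A natural number [b] close to [chi sigma] acts on [zeta] as [a] does, so its [|n|]-th power is 1
    modulo [lbar l]. The exponent [- n] is that of the multiplier of [rho sigma]. *)
Lemma cyclotomic_close1 (zeta : Kbar) sigma : (lbar l).-primitive_root zeta ->
  mu_tensor_kernel Kbar (lbar l) n sigma ->
  cp_norm (chi sigma ^ (- n) - 1) <= cp_norm (4%:R : Ql) / l%:R.
Proof.
have um := cp_ultrametric Ql.
have [m lE [m_gt0 ->]] := lbar_exponent; rewrite lE => prim.
have lm_gt1 : (1 < l ^ m)%N by rewrite -(exp1n m) ltn_exp2r ?prime_gt1.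
move=> /(mu_tensor_kernelP _ lm_gt1 prim)[a [aE an]].
have [chi1 chiE] := chiP sigma.
have [b hb] := nat_approximation pl m chi1.
have : zeta ^+ a = zeta ^+ b by rewrite -aE; apply: chiE hb; exact: prim_expr_order.
move=> /eqP; rewrite (eq_prim_root_expr prim) => /eqP ab.
have bn : (b ^ `|n| = 1 %[mod l ^ m])%N by rewrite -modnXm -ab modnXm.
have small : (l%:R ^- m : R) < 1.
  by rewrite invf_lt1 ?exprn_gt0 ?ltr0n ?prime_gt0 // exprn_egt1 -?lt0n // ltr1n prime_gt1.
(* Ensures that the subtraction of 1 below is not truncated. *)
have b_gt0 : (0 < b ^ `|n|)%N.
  by rewrite lt0n; apply/eqP => b0; move: bn; rewrite b0 mod0n modn_small.
have hn : cp_norm (chi sigma ^+ `|n| - 1) <= l%:R ^- m.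
  have -> : chi sigma ^+ `|n| - 1 = (chi sigma ^+ `|n| - b%:R ^+ `|n|) + (b ^ `|n| - 1)%:R.
    by rewrite natrB // natrX; ring.
  apply: ultrametric_le => //.
    apply: le_trans hb; apply: ultrametric_expB => //; exact: ultrametric_nat.
  by apply: cp_norm_dvd => //; rewrite -eqn_mod_dvd // bn.
have chin1 := ultrametric_close1 um small hn.
have [nE|nE] : n = `|n|%N \/ n = - (`|n|%N : int) by case: n => k; [left|right].
  rewrite nE -exprnN.
  have chin0 : chi sigma ^+ `|n| != 0.
    by apply: contra_eq_neq chin1 => ->; rewrite ultrametric0 // eq_sym oner_eq0.
  have -> : (chi sigma ^+ `|n|)^-1 - 1 = - (chi sigma ^+ `|n| - 1) / chi sigma ^+ `|n|.
    by rewrite opprB mulrBl mul1r divff.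
  by case: (um) => _ _ -> _; rewrite ultrametricN // ultrametricV // chin1 invr1 mulr1.
by rewrite nE opprK.
Qed.

End CyclotomicCharacter.

Section Representation.
Variables (R : realType) (K : fieldType) (Kbar : alg_closure K).
Variables (l : nat) (Ql : padic_field R l) (d : nat) (rho : absGal Kbar -> 'M[Ql]_d).
Hypothesis rhoP : continuous_rep rho.
Implicit Types sigma tau : absGal Kbar.

(** Pointwise equal automorphisms agree on every finite set, so continuity puts their images
    arbitrarily close. This avoids comparing the records themselves. *)
Lemma continuous_rep_ext sigma tau : (forall x, sigma x = tau x) -> rho sigma = rho tau.
Proof.
have um := cp_ultrametric Ql.
case: rhoP => _ _ cont eq_st; apply/matrixP => i j; apply/eqP; rewrite -subr_eq0; apply/eqP.
apply: (ultrametric_eq0 um) => e /(cont tau)[s]; apply => x _; exact: eq_st.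
Qed.

Lemma continuous_rep_inv sigma tau : (forall x, tau (sigma x) = x) ->
  rho tau *m rho sigma = 1%:M.
Proof.
by move=> tauK; case: rhoP => <- <- _; apply: continuous_rep_ext.
Qed.

End Representation.

(** * Connected sets and isometry groups *)

Section ConnectedSubsets.
Variables (k : fieldType) (Om : alg_closure k) (d : nat) (T : set 'M[k]_d).
Hypothesis T_unit : forall a, T a -> a \in unitmx.
Hypothesis T_mul : forall a b, T a -> T b -> T (a *m b).
Hypothesis T_inv : forall a, T a -> T (invmx a).
Hypothesis T_one : T 1%:M.
Local Notation emb := (map_mx (ac_emb Om)).
Local Notation C := (closure_of (emb @` T) : set 'M[Om]_d).

Variables (I : Type) (r : I -> 'M[k]_d) (N : nat) (cls : I -> nat).
Hypothesis r_unit : forall s, r s \in unitmx.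
Hypothesis cls_lt : forall s, (cls s < N)%N.
Hypothesis cls_coset : forall s t, cls s = cls t -> T (invmx (r s) *m r t).

(* A translate of the closure of [T] by some [r s] outside it is disjoint from *)
(* it, and finitely many of these translates cover the rest of [A].            *)
Lemma connected_subset_closure (A : set 'M[Om]_d) :
  A `<=` closure_of [set emb (r s) | s in setT] -> (forall g, A g -> g \in unitmx) ->
  zariski_connected A -> A 1%:M -> A `<=` C.
Proof.
move=> Asub Aunit Aconn A1.
pose bad i s := cls s = i /\ ~ C (emb (r s)).
(* One representative outside [C] is chosen per class, if there is any. The translate of [C] is
   written as a preimage, which shows that it is closed. *)
pose Z i : set 'M[Om]_d := if pselect (exists s, bad i s) is left ex
  then mulmx (invmx (emb (r (sval (cid ex))))) @^-1` C else set0.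
pose C2 : set 'M[Om]_d := [set g | exists2 i, (i < N)%N & Z i g].
have C_closed : zariski_closed C by exact: zariski_closed_closure_of.
have C2_closed : zariski_closed C2.
  apply: zariski_closed_bigcup_lt => i; rewrite /Z; case: pselect => [ex|_]; last first.
    exact: zariski_closed0.
  apply: zariski_closed_preimage => //; apply: polyfun_mulmx.
  - by exists 0 => //; rewrite rmorph0.
  - move=> i' j'; apply: polyfun_const; rewrite -map_invmx mxE.
    by eexists.
  - exact: polyfun_coord.
have C1 : C 1%:M by apply: subset_closure_of; exists 1%:M => //; rewrite map_mx1.
(* Invertible matrices in the closure behave as a group: if [g] and [invmx x *m g] are both in [C],
   so is [x]. Singular matrices could lie in both sets. *)
have disj g : g \in unitmx -> C g -> C2 g -> False.
  move=> ug Cg [j _]; rewrite /Z; case: pselect => // ex.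
  case: (cid ex) => s [_ nCs] /= Cs; apply: nCs.
  set x := emb (r s) in Cs *; have ux : x \in unitmx by rewrite map_unitmx.
  have uy : invmx x *m g \in unitmx by rewrite unitmx_mul unitmx_inv ux.
  have -> : x = g *m invmx (invmx x *m g) by rewrite -{1}(mulKVmx ux g) mulmxK.
  by apply: closure_of_mulmx => //; exact: closure_of_invmx.
have cover : A `<=` C `|` C2.
  apply: subset_trans Asub _; apply: closure_of_min; first exact: zariski_closedU.
  move=> _ [s _ <-]; case: (pselect (C (emb (r s)))) => [Cs|nCs]; [by left|right].
  exists (cls s) => //; rewrite /Z; case: pselect => [ex|]; last by case; exists s.
  case: (cid ex) => t [tE _] /=; apply: subset_closure_of.
  by exists (invmx (r t) *m r s); [exact: cls_coset | rewrite map_mxM map_invmx].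
have [] := Aconn C C2 C_closed C2_closed cover => //.
  apply/seteqP; split=> g // [[Ag Cg] C2g].
  exact: disj (Aunit _ Ag) Cg C2g.
(* The other alternative would put the identity in [C2]. *)
by move=> /(_ _ A1) /(disj _ (unitmx1 _ _) C1).
Qed.

End ConnectedSubsets.

Section BilinearForms.
Variables (E : fieldType) (d : nat).
Implicit Types B g : 'M[E]_d.

Lemma bform_delta B i j : bform B (delta_mx i 0) (delta_mx j 0) = B i j.
Proof. by rewrite /bform trmx_delta -rowE -colE !mxE. Qed.

Lemma bform_mulmx B g v w : bform B (g *m v) (g *m w) = bform (g^T *m B *m g) v w.
Proof. by rewrite /bform trmx_mul !mulmxA. Qed.

Lemma bform_scale B c v w : bform (c *: B) v w = c * bform B v w.
Proof. by rewrite /bform -scalemxAr -scalemxAl mxE. Qed.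

Lemma bform_inj B B' : (forall v w, bform B v w = bform B' v w) -> B = B'.
Proof. by move=> h; apply/matrixP => i j; rewrite -!bform_delta h. Qed.

Lemma IsoE B g : Iso B g <-> g \in unitmx /\ g^T *m B *m g = B.
Proof.
split=> [] [ug h]; split=> //; last by move=> v w; rewrite bform_mulmx h.
by apply: bform_inj => v w; rewrite -bform_mulmx h.
Qed.

Lemma Iso_GIso B : Iso B `<=` GIso B.
Proof. by move=> g [ug h]; split=> //; exists 1; rewrite ?oner_eq0 // => v w; rewrite mul1r. Qed.

Lemma Iso1 B : Iso B 1%:M.
Proof. by apply/IsoE; rewrite unitmx1 trmx1 mul1mx mulmx1. Qed.

Lemma IsoM B g h : Iso B g -> Iso B h -> Iso B (g *m h).
Proof.
move=> [ug gB] [uh hB]; split; first by rewrite unitmx_mul ug.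
by move=> v w; rewrite -!mulmxA gB hB.
Qed.

Lemma IsoV B g : Iso B g -> Iso B (invmx g).
Proof.
move=> [ug gB]; split; first by rewrite unitmx_inv.
by move=> v w; rewrite -gB !mulKVmx.
Qed.

End BilinearForms.

Lemma Iso_map (E E' : fieldType) (f : {rmorphism E -> E'}) d (B g : 'M[E]_d) :
  Iso B g -> Iso (map_mx f B) (map_mx f g).
Proof.
by move=> /IsoE[ug e]; apply/IsoE; rewrite map_unitmx map_trmx -!map_mxM e.
Qed.


Section Density.
Variables (k : fieldType) (Om : alg_closure k) (d : nat) (B : 'M[k]_d).
Local Notation emb := (map_mx (ac_emb Om)).

Lemma polyfun_isometry i j :
  polyfun (range (ac_emb Om)) (fun g : 'M[Om]_d => (g^T *m emb B *m g) i j).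
Proof.
have z0 : range (ac_emb Om) 0 by exists 0 => //; rewrite rmorph0.
move: i j; apply: polyfun_mulmx => // [|i j]; last exact: polyfun_coord.
apply: polyfun_mulmx => // i j; rewrite ?mxE; last exact: polyfun_scalar.
by apply: eq_polyfun (polyfun_coord _ j i) => g; rewrite mxE.
Qed.

(** Only the equations of an isometry are closed in the space of all matrices, so invertibility is
    kept apart. *)
Lemma zariski_closed_Iso : exists2 Z : set 'M[Om]_d, zariski_closed Z &
  Iso (emb B) = [set g | g \in unitmx] `&` Z.
Proof.
exists (\bigcap_(p : 'I_d * 'I_d) [set g : 'M[Om]_d |
  (g^T *m emb B *m g) p.1 p.2 - emb B p.1 p.2 = 0]).
  apply: zariski_closed_bigcap => -[i j] /=; apply: zariski_closed_zeros.
  apply: polyfun_add; first exact: polyfun_isometry.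
  by rewrite mxE -rmorphN; exact: polyfun_scalar.
apply/seteqP; split=> [g /IsoE[ug e]|g [ug e]].
  by split=> // p _ /=; rewrite e subrr.
apply/IsoE; split=> //; apply/matrixP => i j; apply/eqP; rewrite -subr_eq0.
by apply/eqP; exact: (e (i, j) Logic.I).
Qed.

(* If every element of [S] is a scalar multiple of an isometry in [T], then a  *)
(* polynomial vanishing on [T] and [- T] homogenises to polynomials vanishing  *)
(* on [S].                                                                     *)
Lemma Iso_closure_of (T S : set 'M[k]_d) : (2%:R : Om) != 0 ->
  B != 0 -> T `<=` Iso B ->
  (forall s, S s -> exists (u : k) t, [/\ u != 0, T t & s = u *: t]) ->
  closure_of (emb @` S) `&` Iso (emb B) `<=`
  closure_of (emb @` (T `|` [set - t | t in T])).
Proof.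
move=> two0 B0 TB ST g [gS /IsoE[_ gB]] f pf fT.
have [i [j Bij]] : exists i j, B i j != 0.
  apply: contra_notP (negP B0) => nB; apply/eqP/matrixP => i j; rewrite mxE.
  by apply/eqP; apply: contra_notT nB => Bij; exists i, j.
have eBij : emb B i j != 0 by rewrite mxE fmorph_eq0.
(* The multiplier, read off from one nonzero entry of [B]: quadratic in [x], and 1 on isometries. *)
pose c (x : 'M[Om]_d) := (x^T *m emb B *m x) i j * ac_emb Om (B i j)^-1.
have c1 x : x^T *m emb B *m x = emb B -> c x = 1.
  by move=> xB; rewrite /c xB mxE -rmorphM divff // rmorph1.
have cN x : x^T *m emb B *m x = emb B -> c (- x) = 1.
  by move=> xB; apply: c1; rewrite [(- x)^T]linearN /= mulNmx mulmxN mulNmx opprK.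
have pc : polyfun (range (ac_emb Om)) c.
  by apply: polyfun_mul; [exact: polyfun_isometry | exact: polyfun_scalar].
have cZ u x : c (u *: x) = u ^+ 2 * c x.
  by rewrite /c [(u *: x)^T]linearZ /= -!scalemxAl -scalemxAr !mxE; ring.
have [m [h0 [h1 [p0 p1 hE]]]] := polyfun_homogenize pc cZ pf.
have vanish s : S s -> h0 (emb s) = 0 /\ h1 (emb s) = 0.
  move=> /ST[u [t [u0 Tt ->]]].
  have /IsoE[_ tB] : Iso (emb B) (emb t) by exact/Iso_map/TB.
  set U := ac_emb Om u; have U0 : U != 0 by rewrite fmorph_eq0.
  have ft : f (emb t) = 0 by apply: fT; exists t => //; left.
  have fNt : f (- emb t) = 0.
    by apply: fT; exists (- t); rewrite ?map_mxN //; right; exists t.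
  rewrite map_mxZ -/U.
  (* The pairs [U, t] and [- U, - t] give the same point [U *: t], so both sign combinations of
     [U * h0] and [h1] vanish there; hence each term does. *)
  have := hE U _ (c1 _ tB); have := hE (- U) _ (cN _ tB).
  rewrite ft fNt !mul0r scaleNr scalerN opprK mulNr.
  set a := U * _; set b := h1 _ => e1 e2.
  have b0 : b = 0.
    apply/eqP; have : 2%:R * b == 0 by apply/eqP; rewrite -[RHS]addr0 {1}e1 e2; ring.
    by rewrite mulf_eq0 (negPf two0).
  move: e2; rewrite b0 addr0 => /esym/eqP; rewrite mulf_eq0 (negPf U0) => /eqP ->.
  by [].
have := hE 1 g (c1 _ gB); rewrite !mul1r !scale1r expr1n mulr1 => ->.
rewrite (gS _ p0) ?(gS _ p1) ?addr0 // => _ [s Ss <-]; by case: (vanish s Ss).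
Qed.

End Density.

(** * Algebraic monodromy *)

Lemma polarization_neq0 (R : realType) d (n : int)
    (H : int -> int -> {vspace 'cV[R[i]]_d}) (psi : 'M[rat]_d) :
  polarization n H psi -> (0 < d)%N -> psi != 0.
Proof.
move=> [_ [W [_ _ pos]]] d_gt0; apply/eqP => psi0.
have v0 : const_mx 1 != 0 :> 'cV[R]_d.
  by apply/eqP => /matrixP/(_ (Ordinal d_gt0) 0); rewrite !mxE => /eqP; rewrite oner_eq0.
by have := pos _ v0; rewrite /psiC psi0 map_mx0 /bform mulmx0 mul0mx mxE ltxx.
Qed.

Section Monodromy.
Variables (R : realType) (K : fieldExtType rat) (Kbar : alg_closure K).
Variables (l : nat) (Ql : padic_field R l) (Qlbar : alg_closure Ql).
Variables (chi : absGal Kbar -> Ql) (d : nat) (n : int) (psi : 'M[rat]_d).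
Variable rho : absGal Kbar -> 'M[Ql]_d.
Hypotheses (pl : prime l) (chiP : is_cyclotomic_character chi).
Hypotheses (rhoP : continuous_rep rho) (rho_GIso : forall sigma, GIso (psil Ql psi) (rho sigma)).
Hypotheses (rho_psi : psil_equivariant chi n psi rho) (rho_sc : rho_scalars rho).
Implicit Types sigma tau : absGal Kbar.

Notation emb := (map_mx (ac_emb Qlbar)).
Notation B := (psil Ql psi).
Notation ker := (mu_tensor_kernel Kbar (lbar l) n).

Let um := cp_ultrametric Ql.
Let rho_unit sigma : rho sigma \in unitmx. Proof. by case: (rho_GIso sigma). Qed.
Let rho1 : rho (Defs.gal_one Kbar) = 1%:M. Proof. by case: rhoP. Qed.
Let rhoM sigma tau : rho (Defs.gal_mul sigma tau) = rho sigma *m rho tau.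
Proof. by case: rhoP. Qed.

Lemma lbar_gt1 : (1 < lbar l)%N.
Proof. by rewrite /lbar; case: eqP => // _; exact: prime_gt1. Qed.

Lemma lbar_prim_root : exists zeta : Kbar, (lbar l).-primitive_root zeta.
Proof.
apply: closed_field_prim_root; rewrite -(rmorph_nat (ac_emb Kbar)) fmorph_eq0.
rewrite -(rmorph_nat (in_alg K)) fmorph_eq0 pnatr_eq0 -lt0n ltnW //; exact: lbar_gt1.
Qed.

Lemma rho_invmx sigma tau : (forall x, tau (sigma x) = x) -> rho tau = invmx (rho sigma).
Proof.
move=> tauK; have e := continuous_rep_inv rhoP tauK.
by rewrite -[rho tau](mulmxK (rho_unit sigma)) e mul1mx.
Qed.

(** The multiplier of [rho sigma] is a square [u ^+ 2] with [u] in $1+l\mathbb{Z}_l$. The homothety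
    [u] is some [rho tau], so dividing by it gives an isometry that is still in the image. *)
Lemma mu_tensor_kernel_scalar sigma : ker sigma ->
  exists (u : Ql) t, [/\ u != 0, rho_image1 psi rho t & rho sigma = u *: t].
Proof.
move=> ks; have [zeta prim] := lbar_prim_root.
have [u u2 u1] := padic_sqrt pl (cyclotomic_close1 pl chiP prim ks).
have l1 : (l%:R^-1 : R) < 1 by rewrite invf_lt1 ?ltr0n ?prime_gt0 // ltr1n prime_gt1.
have u0 : u != 0.
  have := ultrametric_close1 um l1 u1; apply: contra_eq_neq => ->.
  by rewrite ultrametric0 // eq_sym oner_eq0.
have [tau tauE] := rho_sc u1; have [tau' [tauK _]] := absGal_inv tau.
exists u, (u^-1 *: rho sigma); split=> //; last by rewrite scalerA divff // scale1r.
split; last first.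
  split; first by rewrite unitmxZ ?unitfE ?invr_eq0.
  move=> v w; rewrite bform_mulmx [(_ *: _)^T]linearZ /= -!scalemxAl -scalemxAr scalerA.
  rewrite bform_scale -bform_mulmx rho_psi -u2 mulrA.
  by field.
exists (Defs.gal_mul tau' sigma) => //.
by rewrite rhoM (rho_invmx tauK) tauE invmx_scalar mul_scalar_mx.
Qed.

Section Component.
Variables (K0 : splittingFieldType K) (e0 : {rmorphism K0 -> Kbar}).
Hypothesis he0 : forall x : K, e0 (x%:A) = ac_emb Kbar x.
Hypothesis K0_component : forall sigma, (forall x : K0, sigma (e0 x) = e0 x) ->
  identity_component (Galg psi rho Qlbar) (to_bar Qlbar (rho sigma)).
Hypothesis K0_disjoint : range e0 `&` fixed_field ker = range (ac_emb Kbar).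

Lemma Galg_kernel : Galg psi rho Qlbar `<=` closure_of (emb @` (rho @` ker)).
Proof.
have [zeta prim] := lbar_prim_root; have N_gt1 := lbar_gt1.
have T_unit a : (rho @` ker) a -> a \in unitmx by move=> [s _ <-].
have T_mul a b : (rho @` ker) a -> (rho @` ker) b -> (rho @` ker) (a *m b).
  move=> [s ks <-] [t kt <-]; exists (Defs.gal_mul s t) => //.
  exact: mu_tensor_kernel_mul N_gt1 prim _ _ ks kt.
have T_inv a : (rho @` ker) a -> (rho @` ker) (invmx a).
  move=> [s ks <-]; have [t [tK _]] := absGal_inv s.
  by exists t; [exact: (mu_tensor_kernel_inv N_gt1 prim tK) | exact: rho_invmx].
have ker1 : ker (Defs.gal_one Kbar) by exact: (mu_tensor_kernel_fix n N_gt1 prim).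
have T_one : (rho @` ker) 1%:M by exists (Defs.gal_one Kbar).
rewrite /Galg zariski_closureE => g [_]; apply: closure_of_min.
  exact: zariski_closed_closure_of.
have zetaN (s : absGal Kbar) : s zeta ^+ lbar l = 1.
  by rewrite -rmorphXn /= (prim_expr_order prim) rmorph1.
(* The exponent of the action on [zeta] takes fewer than [lbar l + 1] values; automorphisms with the
   same exponent differ by one fixing [zeta], hence by an element of the kernel. *)
pose cls s := val (sval (prim_rootP prim (zetaN s))).
have clsE (s : absGal Kbar) : s zeta = zeta ^+ cls s by rewrite /cls; case: (prim_rootP _ _).
have cls_coset s t : cls s = cls t -> (rho @` ker) (invmx (rho s) *m rho t).
  move=> st; have [s' [sK _]] := absGal_inv s; rewrite -(rho_invmx sK) -rhoM.
  exists (Defs.gal_mul s' t) => //; apply: (mu_tensor_kernel_fix n N_gt1 prim).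
  by rewrite /= clsE -st -clsE.
move=> _ [s _ <-].
have [t [kt tE]] := absGal_factorization he0 ker1
  (fun s t => @mu_tensor_kernel_mul _ _ _ _ _ N_gt1 prim s t)
  (proj1 ((seteqP _ _).1 K0_disjoint)) s.
have [t' [tK Kt]] := absGal_inv t.
pose a := Defs.gal_mul t' s.
have -> : rho s = rho t *m rho a.
  by rewrite -rhoM; apply: (continuous_rep_ext rhoP) => x /=; rewrite Kt.
have [|A [AG Aconn A1 Aa]] := @K0_component a.
  by move=> x /=; rewrite tE tK.
rewrite /to_bar map_mxM; apply: (closure_of_mull T_mul); first by exists t.
apply: (connected_subset_closure (r := rho) (cls := cls) (N := lbar l) _ _ _ _ _ _ _ _ _ Aconn) => //.
- by move=> s'; rewrite /cls ltn_ord.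
- by move=> h /AG; rewrite /Galg zariski_closureE => -[].
- by move=> h /AG; rewrite /Galg zariski_closureE => -[[]].
Qed.

End Component.

(** Homogenisation covers [Galg1] by the closure of [T] and its negatives. The connected set joining
    1 to -1 puts -1 in the closure of [T], which therefore absorbs the negatives. *)
Lemma rho_image1_dense : (psi != 0 \/ d = 0%N) ->
  Galg psi rho Qlbar `<=` closure_of (emb @` (rho @` ker)) ->
  identity_component (Galg1 psi rho Qlbar) (- 1%:M) ->
  Galg1 psi rho Qlbar `<=` closure_of (emb @` rho_image1 psi rho).
Proof.
move=> psi0 kernel_dense neg1.
set T := rho_image1 psi rho.
have T_unit a : T a -> a \in unitmx by case=> [[s _ <-]].
have T_mul a b : T a -> T b -> T (a *m b).
  move=> [[s _ sa] Ba] [[t _ tb] Bb]; split; last exact: IsoM.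
  by exists (Defs.gal_mul s t); rewrite // rhoM sa tb.
have T_inv a : T a -> T (invmx a).
  move=> [[s _ sa] Ba]; split; last exact: IsoV.
  by have [t [tK _]] := absGal_inv s; exists t; rewrite // (rho_invmx tK) sa.
have T_one : T 1%:M by split; [exists (Defs.gal_one Kbar) | exact: Iso1].
have cover : Galg1 psi rho Qlbar
    `<=` closure_of (emb @` (T `|` [set - t | t in T])).
  move=> g [/kernel_dense gG gB]; have [p0|d0] := psi0; last first.
    apply: subset_closure_of; exists 1%:M; first by left.
    by apply/matrixP => -[m md]; exfalso; rewrite d0 in md.
  have two0 : (2%:R : Qlbar) != 0.
    by rewrite -(rmorph_nat (ac_emb Qlbar)) fmorph_eq0 Ql_natr_neq0.
  apply: (@Iso_closure_of _ _ _ B T (rho @` ker)) => //.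
  - by rewrite /psil map_mx_eq0.
  - by move=> a [].
  by move=> _ [s ks <-]; exact: mu_tensor_kernel_scalar.
(* The two classes are the signs: [T] and its negatives. *)
pose r (p : {t | T t} * bool) := (-1) ^+ p.2 *: sval p.1.
have C_neg1 : closure_of (emb @` T) (- 1%:M).
  have [A [AG Aconn A1 Am1]] := neg1.
  apply: (connected_subset_closure (T := T) (r := r) (N := 2) (cls := fun p => nat_of_bool p.2) _ _ _ _ _ _ _ _ _ Aconn) => //.
  - by move=> [[t Tt] b]; rewrite /r unitmxZ ?T_unit // unitfE signr_eq0.
  - by move=> [t []].
  - move=> [[s Ts] b] [[t Tt] b'] /= bb; rewrite /r /= -bb.
    have -> : invmx ((-1) ^+ b *: s) *m ((-1) ^+ b *: t) = invmx s *m t.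
      rewrite invmxZ ?unitmxZ ?T_unit ?unitfE ?signr_eq0 // -scalemxAl -scalemxAr scalerA.
      by rewrite mulVf ?signr_eq0 // scale1r.
    by apply: T_mul => //; exact: T_inv.
  - move=> h /AG /cover; apply: closure_of_min; first exact: zariski_closed_closure_of.
    move=> _ [a aT <-]; apply: subset_closure_of; case: aT => [Ta|[t Tt <-]].
      by exists (exist _ a Ta, false); rewrite // /r scale1r.
    by exists (exist _ t Tt, true); rewrite // /r scaleN1r.
  - by move=> h /AG [_ []].
apply: subset_trans cover _; apply: closure_of_min; first exact: zariski_closed_closure_of.
move=> _ [a [Ta|[t Tt <-]] <-]; first by apply: subset_closure_of; exists a.
rewrite map_mxN -[emb t]mulmx1 -mulmxN; exact: (closure_of_mull T_mul).
Qed.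

End Monodromy.

Theorem theorem5p20
  (R : realType) (K : fieldExtType rat) (Kbar : alg_closure K)
  (Q_ : forall l : prime_nat, padic_field R l)
  (Qbar : forall l : prime_nat, alg_closure (Q_ l))
  (chi : forall l : prime_nat, absGal Kbar -> Q_ l)
  (chiP : forall l : prime_nat, is_cyclotomic_character (chi l))
  (* the polarized Hodge structure *)
  (d : nat) (n : int) (hn : n != 0)
  (H : int -> int -> {vspace 'cV[R[i]]_d}) (psi : 'M[rat]_d)
  (hV : hodge_structure n H) (hpsi : polarization n H psi)
  (* the ring D *)
  (D : set 'M[rat]_d) (hD : is_subring D)
  (rho_e : absGal Kbar -> 'M[rat]_d -> 'M[rat]_d)
  (D1 : forall beta, D beta -> hodge_endomorphism H beta)
  (D2 : discrete_galois_action D rho_e)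
  (* the de Rham data *)
  (F : int -> {vspace 'cV[K]_d}) (psiDR : 'M[K]_d)
  (cmp : {rmorphism K -> R[i]} -> 'M[R[i]]_d)
  (hDR : de_rham_comparison n H psi F psiDR cmp)
  (jD : 'M[rat]_d -> 'M[Kbar]_d)
  (DR1 : de_rham_embedding D cmp jD)
  (DR2 : de_rham_preserved n H D cmp)
  (* the family of l-adic representations *)
  (rho : forall l : prime_nat, absGal Kbar -> 'M[Q_ l]_d)
  (hrho : forall l, continuous_rep (rho l))
  (hrho_GIso : forall l sigma, GIso (psil (Q_ l) psi) (rho l sigma))
  (hrho_psi : forall l, psil_equivariant (chi l) n psi (rho l))
  (R1 : strictly_compatible rho)
  (R1_HT : forall (l : prime_nat) (w : Kbar -> R) (Cw : completion w),
     is_place l w -> hodge_tate_at (chi l) (rho l) Cw)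
  (R2 : forall l, frobenius_weights n (rho l) (Qbar l))
  (R3 : forall (l : prime_nat) (w : Kbar -> R) (Cw : completion w),
     is_place l w ->
     hodge_tate_decomposition (chi l) n (rho l) Cw D F jD)
  (R4 : forall l, D_equivariant (rho l) D rho_e)
  (* the prime l and the extension K0 / K *)
  (l : prime_nat)
  (K0 : splittingFieldType K) (e0 : {rmorphism K0 -> Kbar})
  (he0 : forall x : K, e0 (x%:A) = ac_emb Kbar x)
  (hK0 : galois 1%AS {:K0}%AS)
  (hK0_rho : forall sigma : absGal Kbar,
     identity_component (Galg psi (rho l) (Qbar l)) (to_bar (Qbar l) (rho l sigma))
     <-> (forall x : K0, sigma (e0 x) = e0 x))
  (h1 : range e0 `&` fixed_field (mu_tensor_kernel Kbar (lbar l) n)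
        = range (ac_emb Kbar))
  (h2 : rho_scalars (rho l))
  (h3 : identity_component (Galg1 psi (rho l) (Qbar l)) (- 1%:M)) :
  zariski_closure (GIso (to_bar (Qbar l) (psil (Q_ l) psi)))
    (to_bar (Qbar l) @` rho_image1 psi (rho l))
  = Galg1 psi (rho l) (Qbar l).
Proof.
have pl : prime l by exact: valP.
have psi0 : psi != 0 \/ d = 0%N.
  by have [d0|/(polarization_neq0 hpsi)] := posnP d; [right | left].
rewrite zariski_closureE; apply/seteqP; split=> [g [gG gT]|g gG1].
  (* This inclusion is formal: the closure stays in [Galg], and in [Iso] because isometries are
     closed among invertible matrices. *)
  have [Z Zclosed IsoZ] := zariski_closed_Iso (Qbar l) (psil (Q_ l) psi).
  have ug : g \in unitmx by case: gG.
  split.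
    rewrite /Galg zariski_closureE; split=> //; apply: closure_of_min gT.
      exact: zariski_closed_closure_of.
    by move=> _ [_ [[s _ <-] _] <-]; apply: subset_closure_of; exists s.
  have : ([set h | h \in unitmx] `&` Z) g; last by rewrite -IsoZ.
  split=> //; apply: closure_of_min Zclosed _ _ gT => _ [a [_ /(Iso_map (ac_emb (Qbar l))) aB] <-].
  by move: aB; rewrite IsoZ => -[].
split.
  by case: gG1 => _ /Iso_GIso.
apply: (rho_image1_dense pl (chiP l) (hrho l) (hrho_GIso l) (hrho_psi l) h2 psi0) => //.
apply: (Galg_kernel pl (hrho l) (hrho_GIso l) he0) => // s.
by move=> /hK0_rho.
Qed.
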